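(* Work in a structure of finite Morley rank. Let $\mathfrak{r}$ be a connected, soluble Lie ring of finite Morley rank. Let $V$ be a definable, irreducible, faithful $\mathfrak{r}$-module. Suppose that the characteristic of $V$ satisfies $\operatorname{char} V > \operatorname{RM}(V)$, where $\operatorname{RM}$ denotes Morley rank. Then $\mathfrak{r}$ is abelian and the configuration is definably linear: there is an infinite field $\mathbb{K}$ such that $V \simeq \mathbb{K}_+$ and $\mathfrak{r}$ embeds into the scalars $\mathbb{K}\operatorname{Id}_V$, all definably.
   Context: A Lie ring is an abelian group $(\mathfrak{r};+)$ with a biadditive bracket $[\cdot,\cdot]$ satisfying $[x,x]=0$ and the Jacobi identity. A Lie ring of finite Morley rank is a Lie ring definable in a structure of finite Morley rank; definability refers to this ambient structure, in which the modules considered are also definable. A definable group is connected if it has no proper definable subgroup of finite index; a Lie ring is connected if its additive group is. Abelian means $[\mathfrak{r},\mathfrak{r}]=0$; soluble means that the derived series of $\mathfrak{r}$ reaches $0$ after finitely many steps. For an abelian group $V$, $\operatorname{End}(V)$ is regarded as a Lie ring under $[f,g]=f\circ g-g\circ f$. An action of $\mathfrak{r}$ on $V$ is a Lie ring morphism $\rho\colon\mathfrak{r}\to\operatorname{End}(V)$; it is faithful if $\rho$ is injective, and definable if $(\mathfrak{r};+,[\cdot,\cdot])$, $(V;+)$ and the map $\mathfrak{r}\times V\to V$, $(r,v)\mapsto\rho(r)(v)$, are definable. A definable $\mathfrak{r}$-module is a definable, connected abelian group $V$ with a definable action of $\mathfrak{r}$. It is irreducible if $V$ has no definable, connected, non-trivial,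 proper, $\mathfrak{r}$-invariant subgroup. An irreducible definable module either has $(V;+)$ of prime exponent $p$, in which case its characteristic is $p$, or has $(V;+)$ divisible, in which case its characteristic is $0$. $\mathbb{K}_+$ is the additive group of $\mathbb{K}$. ''All definably'' means that the field $\mathbb{K}$, the isomorphism $V\simeq\mathbb{K}_+$ and the embedding of $\mathfrak{r}$ (through which it acts on $V$) are definable.
   Formalization: The formal theorem also assumes the Lie ring r is nonzero; for r = 0 the claim fails, e.g. V a pure infinite F_p-vector space (Morley rank 1 < p, irreducible, trivially faithful), in which no infinite field is definable. *)

(* Defs.v *)
From HB Require Import structures.
From mathcomp Require Import all_boot all_algebra.
From mathcomp Require Import boolp classical_sets functions cardinality.

Set Implicit Arguments.
Unset Strict Implicit.
Unset Printing Implicit Defensive.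

Import GRing.Theory.
Local Open Scope classical_set_scope.

(** * First-order structures *)

Record language := Language {
  func : Type;
  farity : func -> nat;
  relsym : Type;
  rarity : relsym -> nat
}.

Inductive term (L : language) : Type :=
| Var of nat
| App (f : func L) of ('I_(farity f) -> term L).

(* Variables are de Bruijn indices; satisfaction is classical, so the
   connectives below generate all first-order formulas. *)
Inductive formula (L : language) : Type :=
| Bot
| Eq of term L & term L
| Rel (s : relsym L) of ('I_(rarity s) -> term L)
| Imp of formula L & formula L
| All of formula L.

Record fostruct (L : language) := FOStruct {
  carrier :> Type;
  finterp : forall f : func L, ('I_(farity f) -> carrier) -> carrier;
  rinterp : forall s : relsym L, ('I_(rarity s) -> carrier) -> Prop
}.

Definition scons (T : Type) (x : T) (e : nat -> T) (k : nat) : T :=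
  if k is k'.+1 then e k' else x.

Fixpoint eval L (M : fostruct L) (e : nat -> M) (t : term L) : M :=
  match t with
  | Var k => e k
  | App f u => finterp (fun i => eval e (u i))
  end.

Fixpoint sat L (M : fostruct L) (e : nat -> M) (phi : formula L) : Prop :=
  match phi with
  | Bot => False
  | Eq t u => eval e t = eval e u
  | Rel s u => rinterp (fun i => eval e (u i))
  | Imp phi psi => sat e phi -> sat e psi
  | All phi => forall x : M, sat (scons x e) phi
  end.

(* The set of n-tuples x satisfying phi, where variable k < n is read as the
   k-th coordinate of x, and variable k >= n as the parameter e k. *)
Definition defset L (M : fostruct L) n (phi : formula L) (e : nat -> M) :
    set (n.-tuple M) :=
  [set x | sat (fun k => nth (e k) x k) phi].
Arguments defset {L M} n phi e.

Definition definable L (M : fostruct L) n (X : set (n.-tuple M)) : Prop :=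
  exists (phi : formula L) (e : nat -> M), X = defset n phi e.

(** * Morley rank *)

Definition elementary_embedding L (M N : fostruct L) (j : M -> N) : Prop :=
  forall (phi : formula L) (e : nat -> M), sat e phi <-> sat (j \o e) phi.

(* Every finitely satisfiable set p of formulas in the variable 0, with
   parameters among the finitely many elements of b :: a, is realised. *)
Definition omega_saturated L (N : fostruct L) : Prop :=
  forall (b : N) (a : seq N) (p : set (formula L)),
    (forall m (phi : 'I_m -> formula L), (forall i, p (phi i)) ->
       exists x : N, forall i, sat (nth b (x :: a)) (phi i)) ->
    exists x : N, forall phi, p phi -> sat (nth b (x :: a)) phi.

(* This is the Morley rank only when evaluated in an omega-saturated N. *)
Fixpoint rank_ge L (N : fostruct L) n (d : nat) (X : set (n.-tuple N)) : Prop :=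
  if d is d'.+1 then
    exists F : nat -> set (n.-tuple N),
      [/\ forall i, definable (F i), forall i, F i `<=` X,
          trivIset setT F & forall i, rank_ge d' (F i)]
  else X !=set0.

(* RM(X) = d: the rank is computed on the extension of X to an
   omega-saturated elementary extension of M. *)
Definition morley_rank L (M : fostruct L) n (X : set (n.-tuple M)) (d : nat) :
    Prop :=
  exists (N : fostruct L) (j : M -> N) (phi : formula L) (e : nat -> M),
    [/\ elementary_embedding j, omega_saturated N, X = defset n phi e,
        rank_ge d (defset n phi (j \o e)) &
        ~ rank_ge d.+1 (defset n phi (j \o e))].

Definition finite_morley_rank L (M : fostruct L) : Prop :=
  exists d, morley_rank [set: 1.-tuple M] d.

(** * Definable objects *)

(* A definable object is a type T together with an identification of T with a
   definable set of tuples; definability of subsets of T and of maps is read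
   through that identification. *)
Record code L (M : fostruct L) (T : Type) := Code {
  cdim : nat;
  cfun :> T -> cdim.-tuple M
}.

Definition prod_code L (M : fostruct L) T U (c : code M T) (d : code M U) :
    code M (T * U) :=
  Code (fun x => [tuple of c x.1 ++ d x.2]).

Definition definable_type L (M : fostruct L) T (c : code M T) : Prop :=
  injective c /\ definable (range c).

Definition definable_in L (M : fostruct L) T (c : code M T) (A : set T) : Prop :=
  definable (c @` A).

Definition definable_map L (M : fostruct L) T U (c : code M T) (d : code M U)
    (f : T -> U) : Prop :=
  definable_in (prod_code c d) [set x | f x.1 = x.2].

Local Open Scope ring_scope.

Definition definable_group L (M : fostruct L) (G : zmodType) (c : code M G) :
    Prop :=
  definable_type c /\
  definable_map (prod_code c c) c (fun x => x.1 + x.2).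

Definition definable_field L (M : fostruct L) (K : fieldType) (c : code M K) :
    Prop :=
  definable_group c /\
  definable_map (prod_code c c) c (fun x => x.1 * x.2).

Definition finite_index (G : zmodType) (H W : set G) : Prop :=
  exists s : seq G, forall w, W w -> exists2 u, u \in s & H (w - u).

Definition connected L (M : fostruct L) (G : zmodType) (c : code M G)
    (W : set G) : Prop :=
  forall H : set G, zmod_closed (mem H) -> definable_in c H -> H `<=` W ->
    finite_index H W -> H = W.

(** * Lie rings *)

Definition lie_ring (g : zmodType) (br : g -> g -> g) : Prop :=
  [/\ forall x, zmod_morphism (br x),
      forall y, zmod_morphism (br^~ y),
      forall x, br x x = 0 &
      forall x y z, br x (br y z) + br y (br z x) + br z (br x y) = 0].

Definition definable_lie_ring L (M : fostruct L) (g : zmodType) (c : code M g)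
    (br : g -> g -> g) : Prop :=
  [/\ lie_ring br, definable_group c &
      definable_map (prod_code c c) c (fun x => br x.1 x.2)].

Definition lie_commutator (g : zmodType) (br : g -> g -> g) (A B : set g) :
    set g :=
  smallest (fun H : set g => zmod_closed (mem H)) [set br x y | x in A & y in B].

Definition lie_abelian (g : zmodType) (br : g -> g -> g) : Prop :=
  lie_commutator br setT setT = [set 0].

Definition lie_derived (g : zmodType) (br : g -> g -> g) (n : nat) : set g :=
  iter n (fun A => lie_commutator br A A) setT.

Definition lie_soluble (g : zmodType) (br : g -> g -> g) : Prop :=
  exists n, lie_derived br n = [set 0].

(** * Modules *)

Definition lie_action (g V : zmodType) (br : g -> g -> g) (rho : g -> V -> V) :
    Prop :=
  [/\ forall x, zmod_morphism (rho x),
      forall v, zmod_morphism (rho^~ v) &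
      forall x y v, rho (br x y) v = rho x (rho y v) - rho y (rho x v)].

Definition definable_module L (M : fostruct L) (g V : zmodType) (cg : code M g)
    (br : g -> g -> g) (cV : code M V) (rho : g -> V -> V) : Prop :=
  [/\ definable_group cV, connected cV setT, lie_action br rho &
      definable_map (prod_code cg cV) cV (fun x => rho x.1 x.2)].

Definition faithful (g V : zmodType) (rho : g -> V -> V) : Prop :=
  forall x y, rho x =1 rho y -> x = y.

Definition irreducible L (M : fostruct L) (g V : zmodType) (cV : code M V)
    (rho : g -> V -> V) : Prop :=
  forall W : set V, zmod_closed (mem W) -> definable_in cV W -> connected cV W ->
    (forall x v, W v -> W (rho x v)) -> W = [set 0] \/ W = setT.

Definition exponent (V : zmodType) (n : nat) : Prop :=
  [/\ (0 < n)%N, forall v : V, v *+ n = 0 &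
      forall m, (0 < m < n)%N -> exists v : V, v *+ m != 0].

Definition divisible (V : zmodType) : Prop :=
  forall n, (0 < n)%N -> forall v : V, exists w : V, w *+ n = v.

Definition module_char (V : zmodType) (c : nat) : Prop :=
  (prime c /\ exponent V c) \/ (c = 0%N /\ divisible V).

(* i identifies V with the additive group of K, so that v |-> i^-1 (k * i v) is
   the scalar k Id_V; l is then the embedding of g into the scalars, seen as a
   Lie ring under the commutator bracket. *)
Definition definably_linear L (M : fostruct L) (g V : zmodType) (cg : code M g)
    (br : g -> g -> g) (cV : code M V) (rho : g -> V -> V) : Prop :=
  exists (K : fieldType) (cK : code M K) (i : V -> K) (l : g -> K),
    [/\ definable_field cK /\ infinite_set [set: K],
        [/\ zmod_morphism i, bijective i & definable_map cV cK i],
        [/\ zmod_morphism l, forall x y, l (br x y) = l x * l y - l y * l x,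
            injective l & definable_map cg cK l] &
        forall x v, i (rho x v) = l x * i v].

(* Main.v *)
(** Only the char p case occurs, since d < p.  The bound on [RM V] is used through
    chains of definable subgroups: there is no infinite descending chain, and a
    strictly descending chain of connected ones has length at most d.  These facts
    hold for [rank_ge] computed in M itself, which is a lower bound for the rank in
    a saturated extension.

    Let R be a commutative ring of definable endomorphisms of V, normalised by a
    set S of definable endomorphisms, such that V is irreducible under R and S,
    and containing a nonzero definable connected family.  Take a minimal
    R-submodule W and let P be its annihilator.  Elements of P act nilpotently
    on V, with exponent at most d < p, so differentiating j^n = 0 by D = [s, -] shows
    that D j is nilpotent too; hence P is stable under S, and P = 0 by irreducibility.
    Then every nonzero element of R is bijective on V, R is an infinite definable
    field, and Frobenius is surjective on it by connectedness.  As
    D (g^p) = p g^(p-1) D g = 0, the set S centralises R.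

    Applied to the ring generated by an abelian ideal A (with S the whole Lie ring
    and the family [s, a], s in r), this shows that abelian ideals are central.  If
    r is soluble and not abelian, some ideal b is not central while [b, b] is; then
    there are t, x in b with [t, x] central and nonzero, and the same argument for
    the ring generated by x and the centre, normalised by t, yields [t, x] = 0.
    Once r is abelian, the ring generated by r is the required field. *)
From HB Require Import structures.
Require Import Defs.
From mathcomp Require Import all_boot all_algebra.
From mathcomp Require Import boolp classical_sets functions cardinality.

Set Implicit Arguments.
Unset Strict Implicit.
Unset Printing Implicit Defensive.
Import GRing.Theory.
Local Open Scope classical_set_scope.
Local Open Scope ring_scope.

(** * Definable sets and maps *)

Section Renaming.
Variable L : language.

Fixpoint term_ren (s : nat -> nat) (t : term L) : term L :=
  match t with
  | Var k => Var L (s k)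
  | App f u => App (fun i => term_ren s (u i))
  end.

Definition lift_ren (s : nat -> nat) (k : nat) : nat :=
  if k is k'.+1 then (s k').+1 else 0%N.

Fixpoint formula_ren (s : nat -> nat) (phi : formula L) : formula L :=
  match phi with
  | Bot => Bot L
  | Eq t u => Eq (term_ren s t) (term_ren s u)
  | Rel r u => Rel (fun i => term_ren s (u i))
  | Imp phi psi => Imp (formula_ren s phi) (formula_ren s psi)
  | All phi => All (formula_ren (lift_ren s) phi)
  end.

Lemma eval_ren (M : fostruct L) (s : nat -> nat) (e : nat -> M) t :
  eval e (term_ren s t) = eval (e \o s) t.
Proof.
elim: t => [k //|f u IH] /=; congr finterp; apply/funext => i; exact: IH.
Qed.

Lemma sat_ren (M : fostruct L) (phi : formula L) (s : nat -> nat) (e : nat -> M) :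
  sat e (formula_ren s phi) <-> sat (e \o s) phi.
Proof.
elim: phi s e => [|t u|r u|phi IH1 psi IH2|phi IH] s e /=.
- by [].
- by rewrite !eval_ren.
- suff -> : (fun i => eval e (term_ren s (u i))) = (fun i => eval (e \o s) (u i)).
    by [].
  by apply/funext => i; rewrite eval_ren.
- by rewrite IH1 IH2.
- split=> H x; move: (H x); rewrite IH;
    suff -> : scons x e \o lift_ren s = scons x (e \o s) by [].
  + by apply/funext => -[|k].
  + by apply/funext => -[|k].
Qed.

End Renaming.

(** * Closure properties of definable predicates, sets and maps *)

Section Definability.
Variables (L : language) (M : fostruct L).
Implicit Types (x e : nat -> M) (P Q : (nat -> M) -> Prop).

Definition interleave x e (k : nat) : M := if odd k then e k./2 else x k./2.

(* Even variables are coordinates and odd variables are parameters, so that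
   the number of coordinates need not be tracked. *)
Definition definable_pred P :=
  exists (phi : formula L) e, forall x, P x <-> sat (interleave x e) phi.

Lemma interleave_even x e k : interleave x e k.*2 = x k.
Proof. by rewrite /interleave odd_double doubleK. Qed.

Lemma interleave_odd x e k : interleave x e k.*2.+1 = e k.
Proof. by rewrite /interleave /= odd_double /= uphalf_double. Qed.

Lemma eq_interleave (f : nat -> M) x e :
  (forall k, f k.*2 = x k) -> (forall k, f k.*2.+1 = e k) -> f = interleave x e.
Proof.
move=> h0 h1; apply/funext => k; rewrite /interleave.
by case: ifP => ok; [rewrite -h1|rewrite -h0]; rewrite -[in LHS](odd_double_half k) ok.
Qed.

Definition evens_odds (a b : nat -> nat) (k : nat) : nat :=
  if odd k then b k./2 else a k./2.

Lemma evens_odds_even a b k : evens_odds a b k.*2 = a k.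
Proof. by rewrite /evens_odds odd_double doubleK. Qed.

Lemma evens_odds_odd a b k : evens_odds a b k.*2.+1 = b k.
Proof. by rewrite /evens_odds /= odd_double /= uphalf_double. Qed.

Lemma definable_pred_ext P Q :
  (forall x, P x <-> Q x) -> definable_pred P -> definable_pred Q.
Proof. by move=> h [phi [e H]]; exists phi, e => x; rewrite -h. Qed.

Lemma definable_pred_bot : M -> definable_pred (fun=> False).
Proof. by move=> m; exists (Bot L), (fun=> m). Qed.

Lemma definable_pred_eq i j : M -> definable_pred (fun x => x i = x j).
Proof.
move=> m; exists (Eq (Var L i.*2) (Var L j.*2)), (fun=> m) => x /=.
by rewrite !interleave_even.
Qed.

Lemma definable_pred_cst i (m : M) : definable_pred (fun x => x i = m).
Proof.
exists (Eq (Var L i.*2) (Var L 1)), (fun=> m) => x /=.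
by rewrite !interleave_even.
Qed.

Lemma definable_pred_imp P Q : definable_pred P -> definable_pred Q ->
  definable_pred (fun x => P x -> Q x).
Proof.
move=> [phi [e He]] [psi [f Hf]].
(* The two parameter streams are merged into [interleave e f]: parameter [k] of [phi] becomes
   parameter [2k], hence variable [4k+1], and that of [psi] becomes parameter [2k+1], hence variable
   [4k+3]. *)
exists (Imp (formula_ren (evens_odds double (fun k => k.*2.*2.+1)) phi)
            (formula_ren (evens_odds double (fun k => k.*2.+1.*2.+1)) psi)).
exists (interleave e f) => x /=; rewrite !sat_ren.
have -> : interleave x (interleave e f) \o evens_odds double (fun k => k.*2.*2.+1)
          = interleave x e.
  apply: eq_interleave => k /=; first by rewrite evens_odds_even interleave_even.
  by rewrite evens_odds_odd interleave_odd interleave_even.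
have -> : interleave x (interleave e f) \o evens_odds double (fun k => k.*2.+1.*2.+1)
          = interleave x f.
  apply: eq_interleave => k /=; first by rewrite evens_odds_even interleave_even.
  by rewrite evens_odds_odd interleave_odd interleave_odd.
by rewrite He Hf.
Qed.

Lemma definable_pred_all P : definable_pred P ->
  definable_pred (fun x => forall y, P (scons y x)).
Proof.
move=> [phi [e H]].
(* Under the quantifier variable 0 is the new coordinate 0 and all old variables are shifted by one:
   coordinate [k+1] sits at [2k+1] and parameter [k] at [2k+2]. *)
pose s := evens_odds (fun k => if k is k'.+1 then k'.*2.+1 else 0%N)
                     (fun k => k.*2.+1.+1).
exists (All (formula_ren s phi)), e => x /=.
suff E y : scons y (interleave x e) \o s = interleave (scons y x) e.
  by split=> h y; move: (h y); rewrite H sat_ren E.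
apply: eq_interleave => k /=; rewrite /s.
  by rewrite evens_odds_even; case: k => //= k; rewrite interleave_even.
by rewrite evens_odds_odd /= interleave_odd.
Qed.

Lemma definable_pred_ren P (s : nat -> nat) : definable_pred P ->
  definable_pred (fun x => P (x \o s)).
Proof.
move=> [phi [e H]].
exists (formula_ren (evens_odds (fun k => (s k).*2) (fun k => k.*2.+1)) phi), e => x.
rewrite sat_ren H.
suff -> : interleave x e \o evens_odds (fun k => (s k).*2) (fun k => k.*2.+1) =
  interleave (x \o s) e by [].
apply: eq_interleave => k /=.
  by rewrite evens_odds_even interleave_even.
by rewrite evens_odds_odd interleave_odd.
Qed.

Lemma definable_pred_not P : definable_pred P -> definable_pred (fun x => ~ P x).
Proof.
move=> dP; have [_ [e _]] := dP.
exact: definable_pred_imp dP (definable_pred_bot (e 0%N)).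
Qed.

Lemma definable_pred_and P Q : definable_pred P -> definable_pred Q ->
  definable_pred (fun x => P x /\ Q x).
Proof.
move=> dP dQ; apply: definable_pred_ext (definable_pred_not
  (definable_pred_imp dP (definable_pred_not dQ))) => x.
split; first by move/not_implyP => [? /contrapT ?].
by case=> p q; move/(_ p).
Qed.

Lemma definable_pred_ex P : definable_pred P ->
  definable_pred (fun x => exists y, P (scons y x)).
Proof.
move=> dP; apply: definable_pred_ext (definable_pred_not
  (definable_pred_all (definable_pred_not dP))) => x.
split; first by move/existsNP => [y /contrapT]; exists y.
by case=> y py /(_ y).
Qed.

(** Quantifies over a block of [m] new coordinates placed in front; a stream can stand for the block
    because only its first [m] values are read. *)
Lemma definable_pred_exn m P : definable_pred P ->
  definable_pred (fun x => exists y : nat -> M,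
    P (fun k => if (k < m)%N then y k else x (k - m)%N)).
Proof.
elim: m P => [|m IH] P dP.
  apply: definable_pred_ext dP => x.
  have E y : (fun k => if (k < 0)%N then y k else x (k - 0)%N) = x.
    by apply/funext => k; rewrite ltn0 subn0.
  by split=> [h|[y]]; [exists x|]; rewrite E.
apply: definable_pred_ext (IH _ (definable_pred_ex dP)) => x; split.
  move=> [y [a h]]; exists (scons a y); move: h; congr P.
  by apply/funext => -[|k] //=; rewrite ltnS subSS.
move=> [y h]; exists (y \o succn), (y 0%N); move: h; congr P.
by apply/funext => -[|k] //=; rewrite ltnS subSS.
Qed.

Lemma definable_pred_bigand n (P : nat -> (nat -> M) -> Prop) : M ->
  (forall i, definable_pred (P i)) ->
  definable_pred (fun x => forall i, (i < n)%N -> P i x).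
Proof.
move=> m dP; elim: n => [|n IH].
  by apply: definable_pred_ext (definable_pred_not (definable_pred_bot m)) => x; split=> // _.
apply: definable_pred_ext (definable_pred_and IH (dP n)) => x; split.
  by move=> [h1 h2] i; rewrite ltnS leq_eqVlt => /orP[/eqP->//|]; exact: h1.
by move=> h; split=> [i ?|]; apply: h; rewrite // ltnS ltnW.
Qed.

Lemma mktuple_mkseq n x : [tuple x i | i < n] = mkseq x n :> seq M.
Proof. by rewrite /= /mkseq -val_enum_ord -map_comp. Qed.

Lemma definableP n (X : set (n.-tuple M)) :
  definable X <-> definable_pred (fun x => X [tuple x i | i < n]).
Proof.
split=> [[phi [e ->]]|[phi [e H]]].
  pose s k := if (k < n)%N then k.*2 else k.*2.+1.
  exists (formula_ren s phi), e => x; rewrite sat_ren /defset /=.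
  suff -> : interleave x e \o s = fun k => nth (e k) [tuple x i | i < n] k by [].
  apply/funext => k; rewrite mktuple_mkseq /s /=.
  case: ltnP => kn; last first.
    by rewrite interleave_odd nth_default // size_mkseq.
  by rewrite interleave_even nth_mkseq.
(* Coordinates beyond [n] do not affect membership in [X]; all of them are read as the parameter
   [e 0], which sits at variable [n]. *)
pose s := evens_odds (fun k => if (k < n)%N then k else n) (fun k => (n + k)%N).
exists (formula_ren s phi), (fun k => e (k - n)%N); apply/seteqP.
have E (t : n.-tuple M) : X t <-> sat (fun k => nth (e (k - n)%N) t k) (formula_ren s phi).
  rewrite sat_ren; pose x k := if (k < n)%N then nth (e 0%N) t k else e 0%N.
  suff -> : (fun k => nth (e (k - n)%N) t k) \o s = interleave x e.
    rewrite -H; suff -> : [tuple x i | i < n] = t by [].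
    apply: eq_from_tnth => i; rewrite tnth_mktuple /x ltn_ord.
    by rewrite (tnth_nth (e 0%N)).
  apply: eq_interleave => k /=; rewrite /s.
    rewrite evens_odds_even /x; case: ltnP => kn.
      by apply: set_nth_default; rewrite size_tuple.
    by rewrite nth_default ?size_tuple// subnn.
  by rewrite evens_odds_odd nth_default ?size_tuple ?leq_addr// addKn.
by split=> t /=; rewrite /defset /= E.
Qed.

Lemma definable_inP T (c : code M T) (A : set T) :
  definable_in c A <->
  definable_pred (fun x => exists2 t, A t & c t = mkseq x (cdim c) :> seq M).
Proof.
rewrite /definable_in definableP.
have E x : (c @` A) [tuple x i | i < cdim c] <->
    exists2 t, A t & c t = mkseq x (cdim c) :> seq M.
  split=> -[t At h]; exists t => //; first by rewrite h mktuple_mkseq.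
  by apply: val_inj; rewrite [LHS]h -mktuple_mkseq.
by split; apply: definable_pred_ext => x; rewrite E.
Qed.

Record dtype := Dtype {
  dsort :> Type;
  dcode : code M dsort;
  dcodeP : definable_type dcode
}.

Definition dset (D : dtype) (A : set D) := definable_in (dcode D) A.

Lemma dtype_inhabited (D : dtype) : exists m : M, True.
Proof. by have [_ [_ [e _]]] := dcodeP D; exists (e 0%N). Qed.

Lemma cat_inj (T : Type) (s1 s2 t1 t2 : seq T) :
  size s1 = size s2 -> s1 ++ t1 = s2 ++ t2 -> s1 = s2 /\ t1 = t2.
Proof. by elim: s1 s2 => [|a s1 IH] [|b s2] //= [/IH h] [-> /h[-> ->]]. Qed.

Lemma mkseqD x n m : mkseq x (n + m) = mkseq x n ++ mkseq (x \o addn n) m.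
Proof.
rewrite /mkseq iotaD map_cat add0n; congr (_ ++ _).
by rewrite -[n in iota n m]addn0 iotaDl -map_comp.
Qed.

Lemma prod_code_mkseq T U (c : code M T) (d : code M U) t u x :
  (prod_code c d (t, u) = mkseq x (cdim (prod_code c d)) :> seq M) <->
  c t = mkseq x (cdim c) :> seq M /\
  d u = mkseq (x \o addn (cdim c)) (cdim d) :> seq M.
Proof.
rewrite /= mkseqD; split=> [|[-> ->]//]; apply: cat_inj.
by rewrite size_tuple size_mkseq.
Qed.

Lemma prod_codeP (D E : dtype) : definable_type (prod_code (dcode D) (dcode E)).
Proof.
have [injD dD] := dcodeP D; have [injE dE] := dcodeP E; split.
  move=> [t u] [t' u'] h; have [m _] := dtype_inhabited D.
  have /= h' := congr1 (@tval _ _) h.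
  have [|h1 h2] := cat_inj _ h'; first by rewrite !size_tuple.
  by congr pair; [apply: injD|apply: injE]; apply: val_inj.
move/definable_inP: dD => dD; move/definable_inP: dE => dE.
apply/(@definable_inP _ (prod_code (dcode D) (dcode E)) setT).
apply: definable_pred_ext (definable_pred_and dD
  (definable_pred_ren (addn (cdim (dcode D))) dE)) => x; split.
  by move=> [[t _ ht] [u _ hu]]; exists (t, u) => //; apply/prod_code_mkseq.
by move=> [[t u] _ /prod_code_mkseq[ht hu]]; split; [exists t|exists u].
Qed.

Definition dprod (D E : dtype) : dtype := Dtype (prod_codeP D E).

Definition dmap (D E : dtype) (f : D -> E) :=
  definable_map (dcode D) (dcode E) f.

(** Every coordinate of the image is a fixed coordinate of the argument, as for projections and
    pairings. Preimages under such maps need only a renaming of variables, which starts the calculus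
    before maps can be composed. *)
Definition coordinate_map (D E : dtype) (g : D -> E) := exists s, forall t x,
  dcode D t = mkseq x (cdim (dcode D)) :> seq M ->
  dcode E (g t) = mkseq (x \o s) (cdim (dcode E)) :> seq M.

Lemma dset_coordinate (D E : dtype) (g : D -> E) (A : set E) :
  coordinate_map g -> dset A -> dset [set t : D | A (g t)].
Proof.
move=> [s Hs] /definable_inP dA; apply/definable_inP.
have [_ /definable_inP dD] := dcodeP D; have [injE _] := dcodeP E.
apply: definable_pred_ext (definable_pred_and dD (definable_pred_ren s dA)) => x.
split.
  move=> [[t _ ht] [u Au hu]]; exists t => //=.
  by suff -> : g t = u by []; apply/injE/val_inj; rewrite /= hu (Hs _ _ ht).
by move=> [t Agt ht]; split; [exists t|exists (g t) => //; exact: Hs].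
Qed.

Lemma coordinate_id (D : dtype) : coordinate_map (id : D -> D).
Proof. by exists id. Qed.

Lemma coordinate_fst (D E F : dtype) (g : D -> dprod E F) :
  coordinate_map g -> @coordinate_map D E (fun t => (g t).1).
Proof.
move=> [s Hs]; exists s => t x /Hs; case: (g t) => u v /= H.
by have [] := (@prod_code_mkseq _ _ (dcode E) (dcode F) u v (x \o s)).1 H.
Qed.

Lemma coordinate_snd (D E F : dtype) (g : D -> dprod E F) :
  coordinate_map g -> @coordinate_map D F (fun t => (g t).2).
Proof.
move=> [s Hs]; exists (s \o addn (cdim (dcode E))) => t x /Hs; case: (g t) => u v /= H.
by have [] := (@prod_code_mkseq _ _ (dcode E) (dcode F) u v (x \o s)).1 H.
Qed.

Lemma coordinate_pair (D E F : dtype) (g : D -> E) (h : D -> F) :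
  coordinate_map g -> coordinate_map h ->
  @coordinate_map D (dprod E F) (fun t => (g t, h t)).
Proof.
move=> [s Hs] [s' Hs'].
exists (fun k => if (k < cdim (dcode E))%N then s k else s' (k - cdim (dcode E))%N).
move=> t x ht; apply/prod_code_mkseq; rewrite (Hs _ _ ht) (Hs' _ _ ht); split.
  by apply/eq_in_map => i; rewrite mem_iota /= => ->.
by apply: eq_mkseq => i /=; rewrite ltnNge leq_addr /= addKn.
Qed.

Lemma dset_ext (D : dtype) (A B : set D) :
  (forall t, A t <-> B t) -> dset A -> dset B.
Proof. by move=> h; suff -> : A = B by []; apply/seteqP; split=> t /h. Qed.

Lemma dset_and (D : dtype) (P Q : D -> Prop) :
  dset [set t | P t] -> dset [set t | Q t] -> dset [set t | P t /\ Q t].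
Proof.
move=> /definable_inP dA /definable_inP dB; apply/definable_inP.
have [inj _] := dcodeP D.
apply: definable_pred_ext (definable_pred_and dA dB) => x; split.
  move=> [[t At ht] [u Bu hu]]; exists t => //; split=> //.
  by suff -> : t = u by []; apply/inj/val_inj; rewrite /= ht hu.
by move=> [t [At Bt] ht]; split; exists t.
Qed.

Lemma dset_not (D : dtype) (P : D -> Prop) :
  dset [set t | P t] -> dset [set t | ~ P t].
Proof.
move=> /definable_inP dA; apply/definable_inP.
have [inj /definable_inP dD] := dcodeP D.
apply: definable_pred_ext (definable_pred_and dD (definable_pred_not dA)) => x.
split.
  by move=> [[t _ ht] nA]; exists t => //= At; apply: nA; exists t.
move=> [t nAt ht]; split; first by exists t.
move=> [u Au hu]; apply: nAt.
by suff -> : t = u by []; apply/inj/val_inj; rewrite /= ht hu.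
Qed.

Lemma dset_imp (D : dtype) (P Q : D -> Prop) :
  dset [set t | P t] -> dset [set t | Q t] -> dset [set t | P t -> Q t].
Proof.
move=> dP dQ; apply: dset_ext (dset_not (dset_and dP (dset_not dQ))) => t /=.
split=> [h p|h [p q]]; last by apply: q; exact: h.
by apply: contrapT => q; apply: h.
Qed.

Lemma dset_or (D : dtype) (P Q : D -> Prop) :
  dset [set t | P t] -> dset [set t | Q t] -> dset [set t | P t \/ Q t].
Proof.
move=> dP dQ; apply: dset_ext (dset_imp (dset_not dP) dQ) => t /=.
split=> [h|[p n|q _//]]; last by case: (n p).
by case: (pselect (P t)) => [p|/h q]; [left|right].
Qed.

Lemma dset_ex (D E : dtype) (P : D -> E -> Prop) :
  @dset (dprod D E) [set z | P z.1 z.2] -> dset [set t | exists u, P t u].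
Proof.
move=> /definable_inP dA; apply/definable_inP.
pose n := cdim (dcode D); pose m := cdim (dcode E).
(* The quantified block comes first in [definable_pred_exn] but second in the code of a product; [s]
   exchanges the two. *)
pose s k := if (k < n)%N then (k + m)%N else (k - n)%N.
apply: definable_pred_ext (definable_pred_exn m (definable_pred_ren s dA)) => x.
have E1 y : mkseq ((fun k => if (k < m)%N then y k else x (k - m)%N) \o s) n = mkseq x n.
  apply/eq_in_map => i; rewrite mem_iota /= /s => ->.
  by rewrite ltnNge leq_addl /= addnK.
have E2 y : mkseq (((fun k => if (k < m)%N then y k else x (k - m)%N) \o s) \o addn n) m
     = mkseq y m.
  apply/eq_in_map => i; rewrite mem_iota /= /s => im.
  have -> : (n + i < n)%N = false by apply/negbTE; rewrite -leqNgt leq_addr.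
  by rewrite addKn im.
split.
  move=> [y [[t u] Ptu /prod_code_mkseq [ht hu]]]; exists t; first by exists u.
  by rewrite ht E1.
move=> [t [u Ptu] ht]; have [m0 _] := dtype_inhabited D.
exists (nth m0 (dcode E u)), (t, u) => //; apply/prod_code_mkseq.
rewrite E1 E2 ht; split=> //.
by have := mkseq_nth m0 (dcode E u); rewrite size_tuple => ->.
Qed.

Lemma dset_setT (D : dtype) : @dset D setT.
Proof. by have [] := dcodeP D. Qed.

Lemma dset_set1 (D : dtype) (a : D) : dset [set t | t = a].
Proof.
have [m0 _] := dtype_inhabited D; apply/definable_inP.
apply: definable_pred_ext (@definable_pred_bigand (cdim (dcode D))
  (fun i x => x i = nth m0 (dcode D a) i) m0 _) => [x|i]; last first.
  exact: definable_pred_cst.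
split=> [h|[t -> ht] i lt_i].
  exists a => //; apply: (@eq_from_nth _ m0); rewrite ?size_tuple ?size_mkseq// => i lt_i.
  by rewrite nth_mkseq// h.
by rewrite ht nth_mkseq.
Qed.

Lemma dset_diagonal (D : dtype) : @dset (dprod D D) [set z | z.1 = z.2].
Proof.
have [m0 _] := dtype_inhabited D.
pose n := cdim (dcode D); apply/definable_inP.
have := @definable_pred_bigand n (fun i x => x i = x (n + i)%N) m0
  (fun i => definable_pred_eq _ _ m0).
have [inj /definable_inP dD] := dcodeP D.
move=> h; apply: definable_pred_ext (definable_pred_and h dD) => x; split.
  move=> [h1 [t _ ht]]; exists (t, t) => //; apply/prod_code_mkseq; split=> //.
  by rewrite ht; apply/eq_in_map => i; rewrite mem_iota => /h1.
move=> [[t u] /= tu /prod_code_mkseq[ht hu]]; rewrite -tu in hu.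
split; last by exists t.
move=> i lt_i; move: hu; rewrite ht => /(congr1 (fun s => nth m0 s i)).
by rewrite !nth_mkseq.
Qed.

Lemma dmap_coordinate (D E : dtype) (g : D -> E) : coordinate_map g -> dmap g.
Proof.
move=> Hg; rewrite /dmap /definable_map.
apply: (@dset_coordinate (dprod D E) (dprod E E)
  (fun z => (g z.1, z.2)) [set z | z.1 = z.2]); last exact: dset_diagonal.
apply: coordinate_pair; last exact/coordinate_snd/coordinate_id.
have [s Hs] := Hg; exists s => -[t u] x /prod_code_mkseq[ht _]; exact: Hs.
Qed.

Lemma dmap_id (D : dtype) : dmap (id : D -> D).
Proof. exact/dmap_coordinate/coordinate_id. Qed.

Lemma dmap_comp (D E F : dtype) (g : E -> F) (f : D -> E) :
  dmap g -> dmap f -> dmap (fun t => g (f t)).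
Proof.
move=> dg df; rewrite /dmap /definable_map.
apply: (@dset_ext (dprod D F) [set z | exists u : E, f z.1 = u /\ g u = z.2]).
  by move=> [t w] /=; split=> [[u [<-]]//|h]; exists (f t).
apply: (@dset_ex (dprod D F) E (fun z u => f z.1 = u /\ g u = z.2)).
apply: dset_and.
  apply: (@dset_coordinate (dprod (dprod D F) E) (dprod D E) (fun z => (z.1.1, z.2))
    [set z | f z.1 = z.2]) => //.
  by apply: coordinate_pair; [apply: coordinate_fst|];
     [apply: coordinate_fst|apply: coordinate_snd]; exact: coordinate_id.
apply: (@dset_coordinate (dprod (dprod D F) E) (dprod E F) (fun z => (z.2, z.1.2))
    [set z | g z.1 = z.2]) => //.
apply: coordinate_pair; first exact/coordinate_snd/coordinate_id.
exact/(@coordinate_snd _ D F)/coordinate_fst/coordinate_id.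
Qed.

Lemma dmap_pair (D E F : dtype) (f : D -> E) (g : D -> F) :
  dmap f -> dmap g -> @dmap D (dprod E F) (fun t => (f t, g t)).
Proof.
move=> df dg; rewrite /dmap /definable_map.
apply: (@dset_ext (dprod D (dprod E F)) [set z | f z.1 = z.2.1 /\ g z.1 = z.2.2]).
  by move=> [t [u v]]; split=> /= [[-> ->]//|[-> ->]].
have h1 := coordinate_fst (coordinate_id (dprod D (dprod E F))).
have h2 := coordinate_snd (coordinate_id (dprod D (dprod E F))).
apply: dset_and.
  apply: (@dset_coordinate (dprod D (dprod E F)) (dprod D E) (fun z => (z.1, z.2.1))
    [set z | f z.1 = z.2]) => //.
  exact/coordinate_pair/coordinate_fst/h2.
apply: (@dset_coordinate (dprod D (dprod E F)) (dprod D F) (fun z => (z.1, z.2.2))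
    [set z | g z.1 = z.2]) => //.
exact/coordinate_pair/coordinate_snd/h2.
Qed.

Lemma dmap_fst (D E F : dtype) (f : D -> dprod E F) :
  dmap f -> @dmap D E (fun t => (f t).1).
Proof.
move=> df; apply: (dmap_comp (g := (fst : dprod E F -> E))) df.
exact/dmap_coordinate/coordinate_fst/coordinate_id.
Qed.

Lemma dmap_snd (D E F : dtype) (f : D -> dprod E F) :
  dmap f -> @dmap D F (fun t => (f t).2).
Proof.
move=> df; apply: (dmap_comp (g := (snd : dprod E F -> F))) df.
exact/dmap_coordinate/coordinate_snd/coordinate_id.
Qed.

Lemma dmap_proj1 (D E : dtype) : @dmap (dprod D E) D (fun z => z.1).
Proof. exact: dmap_fst (dmap_id (dprod D E)). Qed.

Lemma dmap_proj2 (D E : dtype) : @dmap (dprod D E) E (fun z => z.2).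
Proof. exact: dmap_snd (dmap_id (dprod D E)). Qed.

Lemma dset_preim (D E : dtype) (f : D -> E) (P : E -> Prop) :
  dmap f -> dset [set u | P u] -> dset [set t | P (f t)].
Proof.
move=> df dP.
apply: (@dset_ext _ [set t | exists u : E, f t = u /\ P u]).
  by move=> t; split=> [[u [<-]]//|/= h]; exists (f t).
apply: (@dset_ex D E (fun t u => f t = u /\ P u)); apply: dset_and => //.
apply: (@dset_coordinate (dprod D E) E (fun z => z.2) [set u | P u]) => //.
exact/coordinate_snd/coordinate_id.
Qed.

Lemma dmap_cst (D E : dtype) (a : E) : dmap (fun _ : D => a).
Proof.
rewrite /dmap /definable_map.
apply: (@dset_ext (dprod D E) [set z | z.2 = a]) => [[t u]|] /=; first by split=> ->.
apply: (dset_preim (f := (fun z : dprod D E => z.2)) (P := fun u => u = a)).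
  exact/dmap_snd/dmap_id.
exact: dset_set1.
Qed.

Lemma dset_eq (D E : dtype) (f g : D -> E) :
  dmap f -> dmap g -> dset [set t | f t = g t].
Proof.
move=> df dg.
exact: (dset_preim (P := fun z : dprod E E => z.1 = z.2) (dmap_pair df dg)
  (dset_diagonal E)).
Qed.

Lemma dset_image (D E : dtype) (f : D -> E) (A : set D) :
  dmap f -> dset A -> dset (f @` A).
Proof.
move=> df dA; apply: (@dset_ext _ [set u | exists t, A t /\ f t = u]).
  by move=> u; split=> [[t [At <-]]|[t At <-]]; [|]; exists t.
apply: (@dset_ex E D (fun u t => A t /\ f t = u)); apply: dset_and.
  exact: (dset_preim (P := A) (dmap_snd (dmap_id (dprod E D)))).
apply: dset_eq; last exact/dmap_fst/dmap_id.
exact/dmap_comp/dmap_snd/dmap_id.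
Qed.

Lemma dmap_graph (D E : dtype) (f : D -> E) :
  @dset (dprod D E) [set z | f z.1 = z.2] -> dmap f.
Proof. by []. Qed.

End Definability.

(** * Rank and index *)

Section ElementaryTransfer.
Variables (L : language) (M N : fostruct L) (j : M -> N).
Hypothesis elem_j : elementary_embedding j.

Definition splice (T : Type) n (x e : nat -> T) (k : nat) : T :=
  if (k < n)%N then x k else e k.

Lemma spliceS (T : Type) n (x e : nat -> T) :
  splice n.+1 x e = scons (x 0%N) (splice n (x \o succn) (e \o succn)).
Proof. by apply/funext => -[|k]. Qed.

(** The formula [phi] preceded by [n] universal quantifiers holds in [M], hence in [N]; each
    quantifier shifts the parameters by one. *)
Lemma elementary_closure n (phi : formula L) (e : nat -> M) :
  (forall x, sat (splice n x e) phi) ->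
  forall y, sat (splice n y (j \o e)) phi.
Proof.
elim: n phi e => [|n IH] phi e h y.
  exact/elem_j/(h e).
rewrite spliceS; apply: (IH (All phi) (e \o succn) _ (y \o succn)) => x a /=.
by have := h (scons a x); rewrite spliceS.
Qed.

Lemma defsetE (K : fostruct L) (a : K) n phi (e : nat -> K) (x : n.-tuple K) :
  defset n phi e x <-> sat (splice n (nth a x) e) phi.
Proof.
rewrite /defset /=; suff -> : (fun k => nth (e k) x k) = splice n (nth a x) e by [].
apply/funext => k; rewrite /splice; case: ltnP => kn.
  by apply: set_nth_default; rewrite size_tuple.
by rewrite nth_default ?size_tuple.
Qed.

Lemma elementary_imp n (phi psi : formula L) (e f : nat -> M) :
  (forall x, sat (splice n x e) phi -> sat (splice n x f) psi) ->
  forall y, sat (splice n y (j \o e)) phi -> sat (splice n y (j \o f)) psi.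
Proof.
(* The two parameter streams are woven into one beyond [n]: even offsets carry [e], odd offsets
   carry [f]. *)
pose s k := if (k < n)%N then k else (n + k.*2)%N.
pose t k := if (k < n)%N then k else (n + k.*2.+1)%N.
have Es (T : Type) (x a b : nat -> T) :
    splice n x (fun k => if odd (k - n) then b (k - n)./2 else a (k - n)./2) \o s
    = splice n x a.
  apply/funext => k; rewrite /splice /s /=; case: (ltnP k n) => kn; first by rewrite kn.
  have -> : (n + k.*2 < n)%N = false by apply/negbTE; rewrite -leqNgt leq_addr.
  by rewrite addKn odd_double doubleK.
have Et (T : Type) (x a b : nat -> T) :
    splice n x (fun k => if odd (k - n) then b (k - n)./2 else a (k - n)./2) \o t
    = splice n x b.
  apply/funext => k; rewrite /splice /t /=; case: (ltnP k n) => kn; first by rewrite kn.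
  have -> : (n + k.*2.+1 < n)%N = false by apply/negbTE; rewrite -leqNgt leq_addr.
  by rewrite addKn /= odd_double /= uphalf_double.
move=> h y; pose ef k := if odd (k - n) then f (k - n)./2 else e (k - n)./2.
have := @elementary_closure n (Imp (formula_ren s phi) (formula_ren t psi)) ef _ y.
rewrite /= !sat_ren.
have -> : j \o ef = fun k => if odd (k - n) then (j \o f) (k - n)./2 else (j \o e) (k - n)./2.
  by apply/funext => k /=; rewrite /ef; case: ifP.
rewrite Es Et; apply=> x; rewrite !sat_ren Es Et; exact: h.
Qed.

Lemma stream_defset (K : fostruct L) n phi (e : nat -> K) (x : nat -> K) :
  sat (splice n x e) phi <-> defset n phi e [tuple x i | i < n].
Proof.
rewrite (defsetE (e 0%N)).
suff -> : splice n x e = splice n (nth (e 0%N) [tuple x i | i < n]) e by [].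
apply/funext => k; rewrite /splice; case: ifP => // kn.
by rewrite mktuple_mkseq nth_mkseq.
Qed.

(** The formulas that define a witnessing family in [M] define one in [N]: inclusion and
    disjointness are universal statements with parameters in [M], so they are preserved. *)
Lemma rank_ge_elementary k n (phi : formula L) (e : nat -> M) :
  rank_ge k (defset n phi e) -> rank_ge k (defset n phi (j \o e)).
Proof.
elim: k phi e => [|k IH] phi e /=.
  move=> [x /(defsetE (e 0%N)) Xx]; exists (map_tuple j x); apply/(defsetE (j (e 0%N))).
  move/elem_j: Xx; congr sat; apply/funext => i /=; rewrite /splice.
  case: ifP => //= lt_i; rewrite (nth_map (e 0%N)) ?size_tuple//.
move=> [F [dF FX tF rF]].
have [G HG] : {G : nat -> formula L * (nat -> M) & forall i, F i = defset n (G i).1 (G i).2}.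
  apply: (@choice _ _ (fun i p => F i = defset n p.1 p.2)) => i.
  by have [psi [f ->]] := dF i; exists (psi, f).
exists (fun i => defset n (G i).1 (j \o (G i).2)); split.
- by move=> i; exists (G i).1, (j \o (G i).2).
- move=> i x /(defsetE (j (e 0%N))) Gx; apply/(defsetE (j (e 0%N))).
  apply: elementary_imp Gx => y /stream_defset Gy; apply/stream_defset/(FX i).
  by rewrite HG.
- move=> i i' _ _ [x [/(defsetE (j (e 0%N))) x1 /(defsetE (j (e 0%N))) x2]].
  apply: contrapT => ii'.
  have := @elementary_imp n (G i).1 (Imp (G i').1 (Bot L)) (G i).2 (G i').2 _ _ x1 x2.
  apply=> y /stream_defset y1 /= /stream_defset y2; apply: ii'.
  by apply: tF => //; exists [tuple y i | i < n]; rewrite !HG.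
- by move=> i; apply: IH; rewrite -HG.
Qed.

End ElementaryTransfer.

(** Turns the rank hypothesis into a bound computed inside [M]; the saturated extension disappears
    from here on. *)
Lemma morley_rank_bound (L : language) (M : fostruct L) n (X : set (n.-tuple M)) d :
  morley_rank X d -> ~ rank_ge d.+1 X.
Proof.
move=> [N [j [phi [e [ej _ -> _ nr]]]]] r; apply: nr.
exact: rank_ge_elementary ej d.+1 n phi e r.
Qed.

(** * Rank of subsets of a definable type *)

Section Rank.
Variables (L : language) (M : fostruct L) (D : dtype M).
Implicit Types A B : set D.

Definition rk k A := rank_ge k (dcode D @` A).

Lemma rk0 A a : A a -> rk 0 A.
Proof. by move=> Aa; exists (dcode D a), a. Qed.

Lemma rk0P A : rk 0 A -> A !=set0.
Proof. by move=> [_ [a Aa _]]; exists a. Qed.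

Lemma rank_ge_mono k n (X Y : set (n.-tuple M)) : X `<=` Y -> rank_ge k X -> rank_ge k Y.
Proof.
case: k => [|k] /= XY; first by move=> [x /XY]; exists x.
by move=> [F [dF FX tF rF]]; exists F; split=> // i; exact: subset_trans (FX i) XY.
Qed.

Lemma rk_mono k A B : A `<=` B -> rk k A -> rk k B.
Proof. by move=> AB; apply: rank_ge_mono => _ [a /AB ? <-]; exists a. Qed.

Lemma rkS k A (F : nat -> set D) :
  (forall i, dset (F i)) -> (forall i, F i `<=` A) ->
  (forall i i' a, (i < i')%N -> F i a -> F i' a -> False) ->
  (forall i, rk k (F i)) -> rk k.+1 A.
Proof.
move=> dF FA tF rF; exists (fun i => dcode D @` F i); split=> //.
  by move=> i _ [a /FA Aa <-]; exists a.
move=> i i' _ _ [_ [[a Fa <-] [b Fb]]].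
have [inj _] := dcodeP D => /inj ba; rewrite ba in Fb.
by case: (ltngtP i i') => // h; [case: (tF _ _ a h)|case: (tF _ _ a h)].
Qed.

Lemma rkSP k A : rk k.+1 A -> exists F : nat -> set D,
  [/\ forall i, dset (F i), forall i, F i `<=` A,
      forall i i' a, (i < i')%N -> F i a -> F i' a -> False &
      forall i, rk k (F i)].
Proof.
move=> [F [dF FA tF rF]]; exists (fun i => dcode D @^-1` F i).
have E i : dcode D @` (dcode D @^-1` F i) = F i.
  apply/seteqP; split=> [_ [a Fa <-] //|x Fx].
  by have [a Aa ax] := FA _ _ Fx; exists a => //; rewrite /preimage /= ax.
split.
- by move=> i; rewrite /dset /definable_in E.
- move=> i a /FA [b Ab]; by have [inj _] := dcodeP D => /inj <-.
- move=> i i' a lt_ii' Fa Fa'.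
  suff ii' : i = i' by rewrite ii' ltnn in lt_ii'.
  by apply: tF => //; exists (dcode D a); split.
- by move=> i; rewrite /rk E; exact: rF.
Qed.

Lemma rk_image k A (g : D -> D) : dmap g -> injective g -> rk k A -> rk k (g @` A).
Proof.
move=> dg inj_g; elim: k A => [|k IH] A.
  by move=> /rk0P[a Aa]; apply: (@rk0 _ (g a)); exists a.
move=> /rkSP[F [dF FA tF rF]]; apply: (@rkS _ _ (fun i => g @` F i)).
- by move=> i; exact: dset_image.
- by move=> i _ [a /FA Aa <-]; exists a.
- by move=> i i' _ lt_ii' [a Fa <-] [b Fb /inj_g ba]; rewrite ba in Fb; apply: tF Fa Fb.
- by move=> i; apply: IH.
Qed.

End Rank.

(** * Subgroups and finite index in abelian groups *)

Section Subgroups.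
Variable G : zmodType.
Implicit Types H K W : set G.

Definition subgroup H := zmod_closed (mem H).

Lemma subgroupP H : subgroup H <-> H 0 /\ forall u v, H u -> H v -> H (u - v).
Proof.
split=> -[h0 hB]; split.
- by move: h0; rewrite /= => /set_mem.
- by move=> u v /mem_set Hu /mem_set Hv; apply/set_mem; exact: hB.
- by apply/mem_set.
- by move=> u v /set_mem Hu /set_mem Hv; apply/mem_set; exact: hB.
Qed.

Lemma subgroup0 H : subgroup H -> H 0. Proof. by case/subgroupP. Qed.
Lemma subgroupB H u v : subgroup H -> H u -> H v -> H (u - v).
Proof. by case/subgroupP => _; apply. Qed.
Lemma subgroupN H u : subgroup H -> H u -> H (- u).
Proof. by move=> sH Hu; rewrite -sub0r; apply: subgroupB => //; exact: subgroup0. Qed.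
Lemma subgroupD H u v : subgroup H -> H u -> H v -> H (u + v).
Proof. by move=> sH Hu Hv; rewrite -[v]opprK; apply: subgroupB => //; exact: subgroupN. Qed.

Lemma subgroup_set0 : subgroup [set 0].
Proof. by apply/subgroupP; split=> // u v -> ->; rewrite /= subrr. Qed.

Lemma subgroup_setT : subgroup setT. Proof. by apply/subgroupP. Qed.

Lemma subgroupI H K : subgroup H -> subgroup K -> subgroup (H `&` K).
Proof.
move=> sH sK; apply/subgroupP; split; first by split; exact: subgroup0.
by move=> u v [? ?] [? ?]; split; exact: subgroupB.
Qed.

Definition sumset H K : set G := [set x | exists a b, [/\ H a, K b & x = a + b]].

Lemma sumset_subl H K : subgroup K -> H `<=` sumset H K.
Proof. by move=> sK a Ha; exists a, 0; split; rewrite ?addr0//; exact: subgroup0. Qed.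

Lemma sumset_subr H K : subgroup H -> K `<=` sumset H K.
Proof. by move=> sH b Kb; exists 0, b; split; rewrite ?add0r//; exact: subgroup0. Qed.

Lemma sumset_min H K W : subgroup W -> H `<=` W -> K `<=` W -> sumset H K `<=` W.
Proof.
by move=> sW HW KW _ [a [b [Ha Kb ->]]]; apply: subgroupD => //; [exact: HW|exact: KW].
Qed.

Lemma subgroup_sumset H K : subgroup H -> subgroup K -> subgroup (sumset H K).
Proof.
move=> sH sK; apply/subgroupP; split; first by apply: sumset_subl => //; exact: subgroup0.
move=> _ _ [a [b [Ha Kb ->]]] [a' [b' [Ha' Kb' ->]]].
by exists (a - a'), (b - b'); split; [exact: subgroupB|exact: subgroupB|rewrite opprD addrACA].
Qed.

(** A representative is chosen in each class [R _ i] that meets [W]; the labels [i] may thus come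
    from another group or be pairs of cosets. *)
Lemma finite_index_by (I : eqType) (s : seq I) (R : G -> I -> Prop) H W :
  (forall w, W w -> exists2 i, i \in s & R w i) ->
  (forall w w' i, W w -> W w' -> R w i -> R w' i -> H (w - w')) ->
  finite_index H W.
Proof.
move=> cov same.
have [g Hg] : {g : I -> G & forall i w, W w -> R w i -> W (g i) /\ R (g i) i}.
  apply: (@choice _ _ (fun i x => forall w, W w -> R w i -> W x /\ R x i)) => i.
  case: (pselect (exists w, W w /\ R w i)) => [[w [Ww Rw]]|n].
    by exists w.
  by exists 0 => w Ww Rw; case: n; exists w.
exists (map g s) => w Ww; have [i si Rwi] := cov w Ww.
by exists (g i); [exact: map_f|have [Wg Rg] := Hg _ _ Ww Rwi; exact: same Rwi Rg].
Qed.

Lemma finite_index_trans H K W : finite_index H K -> finite_index K W -> finite_index H W.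
Proof.
move=> [s Hs] [t Ht]; exists [seq a + b | a <- s, b <- t] => w /Ht[b tb /Hs[a sa h]].
by exists (a + b); [exact: allpairs_f|rewrite opprD addrA addrAC].
Qed.

Lemma finite_index_subr H K W : K `<=` W -> finite_index H W -> finite_index H K.
Proof. by move=> KW [s Hs]; exists s => w /KW /Hs. Qed.

Lemma finite_indexI H K W : subgroup H -> subgroup K ->
  finite_index H W -> finite_index K W -> finite_index (H `&` K) W.
Proof.
move=> sH sK [s Hs] [t Ht].
apply: (@finite_index_by _ [seq (a, b) | a <- s, b <- t]
  (fun w i => H (w - i.1) /\ K (w - i.2))).
  move=> w Ww; have [a sa Ha] := Hs w Ww; have [b tb Kb] := Ht w Ww.
  by exists (a, b) => //; exact: allpairs_f.
have E (w w' a : G) : w - w' = (w - a) - (w' - a) by rewrite opprB addrA subrK.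
move=> w w' [a b] _ _ /= [Ha Kb] [Ha' Kb']; split; [rewrite (E _ _ a)|rewrite (E _ _ b)];
  exact: subgroupB.
Qed.

Lemma infinite_index_seq H W : ~ finite_index H W ->
  exists u : nat -> G, (forall i, W (u i)) /\
    forall i k, (i < k)%N -> ~ H (u k - u i).
Proof.
move=> nfi.
have [g Hg] : {g : seq G -> G & forall s, W (g s) /\ forall u, u \in s -> ~ H (g s - u)}.
  apply: (@choice _ _ (fun s x => W x /\ forall u, u \in s -> ~ H (x - u))) => s.
  apply: contrapT => h; apply: nfi; exists s => w Ww.
  apply: contrapT => h'; apply: h; exists w; split=> // u su Hu; apply: h'; by exists u.
(* [ls n] collects the first [n] elements picked; each new one avoids the cosets of all earlier
   ones. *)
pose ls n : seq G := iter n (fun s => g s :: s) [::].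
exists (g \o ls); split=> [i|i k ik] /=; first by have [] := Hg (ls i).
have [_] := Hg (ls k); apply; elim: k ik => // k IH; rewrite ltnS leq_eqVlt.
by case/orP => [/eqP->|/IH h]; rewrite /= inE ?eqxx// h orbT.
Qed.

End Subgroups.

Lemma finite_index_preim (G G' : zmodType) (f : G -> G') (W : set G) (W' H : set G') :
  subgroup H -> (forall u v, W u -> W v -> f (u - v) = f u - f v) ->
  (forall w, W w -> W' (f w)) -> subgroup W -> finite_index H W' ->
  finite_index (W `&` (f @^-1` H)) W.
Proof.
move=> sH fB fW sW [s Hs]; apply: (@finite_index_by _ _ s (fun w i => H (f w - i))).
  by move=> w /fW /Hs.
move=> w w' i Ww Ww' h h'; split; first exact: subgroupB.
rewrite /preimage /= fB//; have -> : f w - f w' = (f w - i) - (f w' - i).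
  by rewrite opprB addrA subrK.
exact: subgroupB.
Qed.

(** * Definable groups and chain conditions *)

Section DefinableGroups.
Variables (L : language) (M : fostruct L).

Record dgroup := Dgroup {
  dgsort :> zmodType;
  dgcode : code M dgsort;
  dgcodeP : definable_group dgcode
}.

Definition dg (G : dgroup) : dtype M := Dtype (proj1 (dgcodeP G)).

Implicit Types G : dgroup.

Lemma dmap_add G (D : dtype M) (f g : D -> G) :
  @dmap _ _ D (dg G) f -> @dmap _ _ D (dg G) g ->
  @dmap _ _ D (dg G) (fun t => f t + g t).
Proof.
move=> df dg'; have [_ dadd] := dgcodeP G.
exact: (dmap_comp (g := fun z : dprod (dg G) (dg G) => (z.1 + z.2 : dg G)) dadd
  (dmap_pair df dg')).
Qed.

Lemma dmap_opp G (D : dtype M) (f : D -> G) :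
  @dmap _ _ D (dg G) f -> @dmap _ _ D (dg G) (fun t => - f t).
Proof.
move=> df; apply: dmap_graph.
apply: (@dset_ext _ _ (dprod D (dg G)) [set z | (f z.1 + z.2 : dg G) = 0]).
  by move=> [t u] /=; split=> [/eqP|<-]; [rewrite addrC addr_eq0 => /eqP->|rewrite subrr].
apply: dset_eq; last exact: dmap_cst.
apply: dmap_add; last exact: dmap_proj2.
exact: (dmap_comp df (dmap_proj1 _ _)).
Qed.

Lemma dmap_sub G (D : dtype M) (f g : D -> G) :
  @dmap _ _ D (dg G) f -> @dmap _ _ D (dg G) g ->
  @dmap _ _ D (dg G) (fun t => f t - g t).
Proof. by move=> df dg'; apply: dmap_add => //; exact: dmap_opp. Qed.

Definition dsub G (H : set G) := subgroup H /\ @dset _ _ (dg G) H.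

Definition cdsub G (W : set G) := dsub W /\ connected (dgcode G) W.

Lemma dsubI G (H K : set G) : dsub H -> dsub K -> dsub (H `&` K).
Proof.
by move=> [sH dH] [sK dK]; split; [exact: subgroupI|exact: (@dset_and _ _ (dg G))].
Qed.

Lemma dsub_set0 G : dsub [set 0 : G].
Proof. by split; [exact: subgroup_set0|exact: (@dset_set1 _ _ (dg G))]. Qed.

Lemma dsub_setT G : dsub [set: G].
Proof. by split; [exact: subgroup_setT|exact: (@dset_setT _ _ (dg G))]. Qed.

(** Additivity is asked on [W] only: the Frobenius map considered below is extended by 0 outside a
    subgroup and need not be additive on the whole group. *)
Definition additive_on (G G' : zmodType) (W : set G) (f : G -> G') :=
  forall u v, W u -> W v -> f (u - v) = f u - f v.

Lemma additive_on0 (G G' : zmodType) (W : set G) (f : G -> G') :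
  subgroup W -> additive_on W f -> f 0 = 0.
Proof.
by move=> /subgroup0 W0 /(_ 0 0 W0 W0); rewrite subrr => ->; rewrite subrr.
Qed.

(** [K] meets [W] in a subgroup of finite index, which is all of [W] by connectedness. *)
Lemma connected_finite_index G (W K U : set G) : cdsub W -> dsub K -> W `<=` U ->
  finite_index K U -> W `<=` K.
Proof.
move=> [[sW dW] cW] [sK dK] WU [s Hs].
suff -> : W = K `&` W by move=> ? [].
symmetry; apply: cW; [exact: subgroupI| |by move=> ? []|].
  exact: (@dset_and _ _ (dg G)).
apply: (@finite_index_by _ _ s (fun w i => K (w - i))).
  by move=> w /WU /Hs.
move=> w w' i Ww Ww' h h'; split; last exact: subgroupB.
by have -> : w - w' = (w - i) - (w' - i); [rewrite opprB addrA subrK|exact: subgroupB].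
Qed.

Lemma dsub_image G (G' : dgroup) (W : set G) (f : G -> G') : dsub W ->
  @dmap _ _ (dg G) (dg G') f -> additive_on W f -> dsub (f @` W).
Proof.
move=> [sW dW] df fB; split; last exact: (@dset_image _ _ (dg G) (dg G')).
apply/subgroupP; split.
  by exists 0; [exact: subgroup0|exact: (additive_on0 sW fB)].
by move=> _ _ [u Wu <-] [v Wv <-]; exists (u - v); [exact: subgroupB|exact: fB].
Qed.

Lemma dsub_preim G (G' : dgroup) (W : set G) (K : set G') (f : G -> G') : dsub W -> dsub K ->
  @dmap _ _ (dg G) (dg G') f -> additive_on W f -> dsub (W `&` f @^-1` K).
Proof.
move=> [sW dW] [sK dK] df fB; split; last first.
  apply: (@dset_and _ _ (dg G) W) => //.
  exact: (@dset_preim _ _ (dg G) (dg G')).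
apply/subgroupP; split.
  by split; [exact: subgroup0|rewrite /preimage /= (additive_on0 sW fB); exact: subgroup0].
move=> u v [Wu Ku] [Wv Kv]; split; first exact: subgroupB.
by rewrite /preimage /= fB//; exact: subgroupB.
Qed.

Lemma cdsub_image G (G' : dgroup) (W : set G) (f : G -> G') : cdsub W ->
  @dmap _ _ (dg G) (dg G') f -> additive_on W f -> cdsub (f @` W).
Proof.
move=> cW df fB; have [dW _] := cW; have dsW := dsub_image dW df fB.
split=> // K sK dK KW fi.
have WK : W `<=` W `&` f @^-1` K.
  apply: (connected_finite_index cW _ (@subset_refl _ W)); first exact: dsub_preim.
  by apply: (@finite_index_preim _ _ f W (f @` W)) => //; case: dW.
by apply/seteqP; split=> // _ [w /WK[_ Kfw] <-].
Qed.

(** A definable subgroup of finite index in the sum contains both summands, since each is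
    connected. *)
Lemma cdsub_sumset G (H K : set G) : cdsub H -> cdsub K -> cdsub (sumset H K).
Proof.
move=> cH cK; have [[sH dH] _] := cH; have [[sK dK] _] := cK.
have dS : dsub (sumset H K).
  split; first exact: subgroup_sumset.
  apply: (@dset_ext _ _ (dg G) [set x | exists a : dg G, exists b : dg G,
     (H a /\ K b) /\ x = (a : G) + b]).
    move=> x; split=> [[a [b [[Ha Kb] ->]]]|[a [b [Ha Kb ->]]]].
      by exists a, b.
    by exists a, b.
  apply: (@dset_ex _ _ (dg G) (dg G)); apply: (@dset_ex _ _ (dprod (dg G) (dg G)) (dg G)
    (fun z b => (H z.2 /\ K b) /\ z.1 = (z.2 : G) + b)).
  set D := dprod (dprod _ _) _.
  have d1 : @dmap _ _ D (dg G) (fun z => z.1.1) by exact: dmap_fst (dmap_proj1 _ _).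
  have d2 : @dmap _ _ D (dg G) (fun z => z.1.2) by exact: dmap_snd (dmap_proj1 _ _).
  have d3 : @dmap _ _ D (dg G) (fun z => z.2) by exact: dmap_proj2.
  apply: dset_and; last by apply: dset_eq => //; exact: dmap_add.
  by apply: dset_and; [exact: dset_preim d2 _|exact: dset_preim d3 _].
split=> // X sX dX XS fi; apply/seteqP; split=> //.
apply: sumset_min => //.
- by apply: (connected_finite_index cH _ _ fi) => //; exact: sumset_subl.
- by apply: (connected_finite_index cK _ _ fi) => //; exact: sumset_subr.
Qed.

Lemma cdsub_finite G (W : set G) : cdsub W -> finite_index [set 0] W -> W = [set 0].
Proof.
move=> cW fi; apply/seteqP; split; last by move=> _ ->; apply: subgroup0; case: cW; case.
exact: connected_finite_index cW (dsub_set0 G) (@subset_refl _ W) fi.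
Qed.

(** [finite_index [set 0] F] says that [F] is finite. The kernel of [h] then has finite index in
    [G], so it is [G]. *)
Lemma connected_finite_image G (G' : dgroup) (h : G -> G') (F : set G') :
  connected (dgcode G) setT -> @dmap _ _ (dg G) (dg G') h ->
  (forall x y, h (x - y) = h x - h y) ->
  finite_index [set 0] F -> (forall x, F (h x)) -> forall x, h x = 0.
Proof.
move=> cG dh hB fi hF.
have cGT : cdsub [set: G] by split=> //; exact: dsub_setT.
have hBT : additive_on [set: G] h by move=> u v _ _; exact: hB.
have : [set: G] `<=` setT `&` h @^-1` [set 0].
  apply: (connected_finite_index cGT _ (@subset_refl _ setT)).
    exact: dsub_preim (dsub_setT G) (dsub_set0 G') dh hBT.
  by apply: (@finite_index_preim _ _ h setT F) => //; [exact: subgroup_set0|exact: subgroup_setT].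
by move=> h0 x; have [] := h0 x.
Qed.

End DefinableGroups.

(** * Chain conditions in a group of bounded rank *)

Section BoundedRank.
Variables (L : language) (M : fostruct L) (V : dgroup M) (d : nat).
Hypothesis rkV : ~ rk (D := dg V) d.+1 setT.
Implicit Types H K W : set V.

Let rkb k (A : set (dg V)) : (d < k)%N -> ~ rk k A.
Proof.
have rkT k' (B : set (dg V)) : rk k' B -> rk k' [set: dg V].
  exact: rk_mono (@subsetT _ _).
elim: k A => // k IH A; rewrite ltnS leq_eqVlt => /orP[/eqP <- /rkT //|/IH h].
by move=> /rkSP[F [_ _ _ /(_ 0%N)]]; exact: h.
Qed.

Let dmap_tr (a : V) : @dmap _ _ (dg V) (dg V) (fun x => x + a).
Proof. by apply: dmap_add; [exact: dmap_id|exact: dmap_cst]. Qed.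

Lemma rk_translate k (A : set V) (a : V) : rk (D := dg V) k A ->
  rk (D := dg V) k [set x | A (x - a)].
Proof.
move=> rA; have := rk_image (dmap_tr a) (@addIr _ a) rA; apply: rk_mono.
by move=> _ [x Ax <-] /=; rewrite addrK.
Qed.

Lemma dset_translate (A : set V) (a : V) : @dset _ _ (dg V) A ->
  @dset _ _ (dg V) [set x | A (x - a)].
Proof. by move=> dA; apply: dset_preim dA; exact: dmap_tr. Qed.

(** Infinitely many cosets of [H] in [W] are pairwise disjoint translates of [H], of the same
    rank. *)
Lemma rk_infinite_index k H W : dsub H -> subgroup W -> H `<=` W ->
  ~ finite_index H W -> rk (D := dg V) k H -> rk (D := dg V) k.+1 W.
Proof.
move=> [sH dH] sW HW /infinite_index_seq[u [Wu Hu]] rH.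
apply: (@rkS _ _ (dg V) _ _ (fun i => [set x | H (x - u i)])).
- by move=> i; exact: dset_translate.
- by move=> i x /= /HW h; rewrite -[x](subrK (u i)); exact: subgroupD.
- move=> i i' a lt_ii' /= h h'; apply: (Hu _ _ lt_ii').
  have -> : u i' - u i = (a - u i) - (a - u i') by rewrite opprB [RHS]addrC addrA subrK.
  exact: subgroupB.
- by move=> i; exact: rk_translate.
Qed.

(** In a strict chain every [H i] would have rank at least [k] for all [k]. With [a j] in [H j] but
    not in [H j.+1], the cosets of [H (i + m).+1] through [a (i + m)] lie in [H i]. They are
    disjoint because a later one lies in [H (i + m).+1], which the earlier one misses. *)
Lemma dsub_descending_chain (H : nat -> set V) : (forall i, dsub (H i)) ->
  (forall i, H i.+1 `<=` H i) -> ~ (forall i, H i.+1 <> H i).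
Proof.
move=> dH sub neq.
have subn i k : H (i + k)%N `<=` H i.
  by elim: k => [|k IH]; rewrite ?addn0// addnS; exact: subset_trans (sub _) IH.
have [a Ha] : {a : nat -> V & forall i, H i (a i) /\ ~ H i.+1 (a i)}.
  apply: (@choice _ _ (fun i x => H i x /\ ~ H i.+1 x)) => i.
  apply: contrapT => h; apply: (neq i); apply/seteqP; split=> // x Hx.
  by apply: contrapT => nHx; apply: h; exists x.
suff h k : forall i, rk (D := dg V) k (H i) by exact: (rkb (ltnSn d) (h d.+1 0%N)).
elim: k => [|k IH] i.
  by apply: (@rk0 _ _ (dg V) _ 0); apply: subgroup0; case: (dH i).
apply: (@rkS _ _ (dg V) _ _ (fun m => [set x | H (i + m).+1 (x - a (i + m)%N)])).
- by move=> m; apply: dset_translate; case: (dH (i + m).+1).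
- move=> m x /= /sub h; apply: (subn i m).
  rewrite -[x](subrK (a (i + m)%N)); apply: subgroupD => //; first by case: (dH (i + m)%N).
  by have [] := Ha (i + m)%N.
- move=> m m' x lt_mm' /= h /sub h'.
  have sH := (dH (i + m).+1).1.
  have Hx : H (i + m).+1 x.
    have ha : H (i + m')%N x.
      rewrite -[x](subrK (a (i + m')%N)); apply: subgroupD => //; first by case: (dH (i + m')%N).
      by have [] := Ha (i + m')%N.
    have := subn (i + m).+1 (m' - m.+1)%N x; apply.
    by rewrite -addnS -addnA subnKC.
  have [_ /=] := Ha (i + m)%N; apply.
  have -> : a (i + m)%N = x - (x - a (i + m)%N) by rewrite opprB addrC subrK.
  exact: subgroupB.
- by move=> m; exact: rk_translate.
Qed.

Lemma dsub_minimal (C : set (set V)) : (forall H, C H -> dsub H) ->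
  C !=set0 -> exists2 H, C H & forall K, C K -> K `<=` H -> K = H.
Proof.
move=> dC [H0 CH0]; apply: contrapT => nmin.
have [g Hg] : {g : set V -> set V & forall H, C H -> [/\ C (g H), g H `<=` H & g H <> H]}.
  apply: (@choice _ _ (fun H K => C H -> [/\ C K, K `<=` H & K <> H])) => H.
  case: (pselect (C H)) => CH; last by exists H.
  apply: contrapT => h; apply: nmin; exists H => // K CK KH.
  by apply: contrapT => KnH; apply: h; exists K.
have CI i : C (iter i g H0) by elim: i => //= i /Hg[].
apply: (@dsub_descending_chain (fun i => iter i g H0)).
- by move=> i; apply: dC.
- by move=> i /=; have [] := Hg _ (CI i).
- by move=> i /=; have [] := Hg _ (CI i).
Qed.

Lemma connected_infinite_index H W : cdsub W -> dsub H -> H `<=` W -> H <> W ->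
  ~ finite_index H W.
Proof. by move=> [_ cW] [sH dH] HW HnW fi; apply: HnW; exact: cW. Qed.

(** A member of largest rank is maximal: a proper inclusion of connected groups has infinite index,
    so it raises the rank. *)
Lemma cdsub_maximal (C : set (set V)) : (forall H, C H -> cdsub H) ->
  C !=set0 -> exists2 H, C H & forall K, C K -> H `<=` K -> K = H.
Proof.
move=> cC [H0 CH0].
pose P k := exists2 H, C H & rk (D := dg V) k H.
have P0 : P 0%N.
  by exists H0 => //; apply: (@rk0 _ _ (dg V) _ 0); apply: subgroup0; case: (cC _ CH0); case.
have [k [[H CH rH] nP]] : exists k, P k /\ ~ P k.+1.
  apply: contrapT => h; have PS k : P k.
    by elim: k => // k Pk; apply: contrapT => nP; apply: h; exists k.
  by have [H _ /(rkb (ltnSn d))] := PS d.+1.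
exists H => // K CK HK; apply: contrapT => KnH; apply: nP; exists K => //.
have [dH _] := cC _ CH; have cK := cC _ CK; have [[sK _] _] := cK.
apply: (rk_infinite_index dH sK HK _ rH).
by apply: connected_infinite_index => // /esym.
Qed.

(** Each step has infinite index by connectedness, so the rank grows by at least one at each step up
    the chain. *)
Lemma cdsub_chain n (X : nat -> set V) : (forall i, cdsub (X i)) ->
  (forall i, (i < n)%N -> X i.+1 `<=` X i /\ X i.+1 <> X i) -> (n <= d)%N.
Proof.
move=> cX HX; rewrite leqNgt; apply/negP => lt_dn.
suff : rk (D := dg V) n (X 0%N) by exact: rkb.
elim: n X cX HX {lt_dn} => [|n IH] X cX HX.
  by apply: (@rk0 _ _ (dg V) _ 0); apply: subgroup0; case: (cX 0%N); case.
have [sub neq] := HX 0%N (ltn0Sn n).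
apply: (@rk_infinite_index _ (X 1%N)) => //.
- by case: (cX 1%N).
- by case: (cX 0%N); case.
- by apply: connected_infinite_index => //; case: (cX 1%N).
- by apply: (IH (fun i => X i.+1)) => // i lt_in; exact: HX.
Qed.

(** [K] is minimal among the definable subgroups of finite index in [H]. Intersecting it with
    another such subgroup shows that it is the least one. *)
Lemma connected_component H : dsub H -> exists K,
  [/\ cdsub K, K `<=` H, finite_index K H &
      forall U, dsub U -> U `<=` H -> finite_index U H -> K `<=` U].
Proof.
move=> dH; pose C : set (set V) := [set K | [/\ dsub K, K `<=` H & finite_index K H]].
have CH : C H.
  by split=> //; exists [:: 0] => w Hw; exists 0; rewrite ?inE// subr0.
have [K [dK KH fiK] minK] := @dsub_minimal C (fun K h => let: And3 h1 _ _ := h in h1)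
  (ex_intro _ H CH).
have min U : dsub U -> U `<=` H -> finite_index U H -> K `<=` U.
  move=> dU UH fiU; suff <- : U `&` K = K by move=> x [].
  apply: minK => [|x []//]; split; [exact: dsubI|by move=> x [/UH]|].
  by apply: finite_indexI => //; [case: dU|case: dK].
exists K; split=> //; split=> // U sU dU UK fi; apply/seteqP; split=> //.
apply: min => //; first exact: subset_trans UK KH.
exact: finite_index_trans fi fiK.
Qed.

(** [K] is the connected component of [H]. If [f] preserves [H], the preimage of [K] under [f] has
    finite index in [H] and so contains [K]. *)
Lemma infinite_cdsub H : dsub H -> ~ finite_index [set 0] H ->
  exists K, [/\ cdsub K, K `<=` H, K <> [set 0] &
   forall f : V -> V, @dmap _ _ (dg V) (dg V) f -> additive_on H f ->
     (forall x, H x -> H (f x)) -> forall x, K x -> K (f x)].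
Proof.
move=> dH nfi; have [K [cK KH fiK minK]] := connected_component dH.
exists K; split=> //; first by move=> K0; apply: nfi; rewrite -K0.
move=> f df fB fH; have [dK _] := cK.
suff KK : K `<=` H `&` f @^-1` K by move=> x /KK[].
apply: minK; [exact: dsub_preim|by move=> ? []|].
by apply: (@finite_index_preim _ _ f H H) => //; [case: dK|case: dH].
Qed.

(** The images [X i] of [W] under iterates of [f] descend, so two consecutive ones agree;
    injectivity cancels [f] and brings the equality down to [X 1 = X 0]. *)
Lemma injective_image W (f : V -> V) : cdsub W -> @dmap _ _ (dg V) (dg V) f ->
  additive_on W f -> (forall x, W x -> W (f x)) ->
  (forall x, W x -> f x = 0 -> x = 0) -> f @` W = W.
Proof.
move=> cW df fB fW f0; have [[sW _] _] := cW.
have inj x y : W x -> W y -> f x = f y -> x = y.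
  move=> Wx Wy fxy; apply/eqP; rewrite -subr_eq0; apply/eqP/f0; first exact: subgroupB.
  by rewrite fB// fxy subrr.
pose X i := iter i (fun A => f @` A) W.
have XW i : X i `<=` W by elim: i => //= i IH _ [x /IH/fW Wfx <-].
have cX i : cdsub (X i).
  elim: i => //= i IH; apply: cdsub_image => // u v /XW Wu /XW Wv; exact: fB.
have XS i : X i.+1 `<=` X i.
  by elim: i => [_ [x /fW Wfx <-]//|i IH _ [x /IH Xx <-]]; exists x.
have [_ [i _ <-] mini] := @dsub_minimal [set X i | i in setT]
  (fun K h => let: ex_intro2 i _ e := h in eq_ind _ (@dsub _ _ _) (cX i).1 _ e)
  (ex_intro _ (X 0%N) (ex_intro2 _ _ 0%N I erefl)).
have : X i.+1 = X i by apply: mini => //; exists i.+1.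
elim: i {mini} => // i IH Ei; apply: IH; apply/seteqP; split=> // x Xx.
have : X i.+2 (f x) by rewrite Ei; exists x.
move=> [y Xy fyx]; have <- // : y = x.
by apply: inj => //; [exact: (XW i.+1 _ Xy)|exact: (XW i _ Xx)].
Qed.

(** With an infinite kernel every preimage gains rank: [step] turns rank [k] of [A] into rank [k.+1]
    of its preimage. Repeated with [A = W], this makes the rank of [W] exceed [d]. *)
Lemma surjective_kernel W (f : V -> V) : dsub W -> @dmap _ _ (dg V) (dg V) f ->
  additive_on W f -> f @` W = W -> finite_index [set 0] (W `&` f @^-1` [set 0]).
Proof.
move=> dW df fB fW; apply: contrapT => /infinite_index_seq[u [Ku u_inj]].
have [sW dsW] := dW.
have step k : forall A : set V, A `<=` W -> rk (D := dg V) k A ->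
    rk (D := dg V) k.+1 (W `&` f @^-1` A).
  elim: k => [|k IH] A AW.
    move=> /rk0P[a Aa]; have [w Ww fwa] : (f @` W) a by rewrite fW; exact: AW.
    (* The fibre over [a] contains the infinitely many points [w + u i]. *)
    apply: (@rkS _ _ (dg V) _ _ (fun i => [set x | x = w + u i])).
    - by move=> i; exact: (@dset_set1 _ _ (dg V)).
    - move=> i _ ->; have [Wu fu] := Ku i; have Wwu := subgroupD sW Ww Wu.
      split=> //; rewrite /preimage /=.
      suff -> : f (w + u i) = a by [].
      by rewrite -fwa -[in RHS](addrK (u i) w) fB// [f (u i)]fu subr0.
    - move=> i i' a' lt_ii' -> /addrI e; apply: (u_inj _ _ lt_ii').
      by rewrite /= e subrr.
    - by move=> i; exact: (@rk0 _ _ (dg V) _ (w + u i)).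
  move=> /rkSP[F [dF FA tF rF]].
  apply: (@rkS _ _ (dg V) _ _ (fun i => W `&` f @^-1` (F i))).
  - move=> i; apply: (@dset_and _ _ (dg V) W) => //.
    exact: (@dset_preim _ _ (dg V) (dg V) f (F i) df (dF i)).
  - by move=> i x [Wx /FA].
  - by move=> i i' x lt_ii' [_ h] [_ h']; exact: tF h h'.
  - by move=> i; apply: IH => // x /FA /AW.
have rW k : rk (D := dg V) k W.
  elim: k => [|k /(step k W (@subset_refl _ W))].
    exact: (@rk0 _ _ (dg V) _ 0 (subgroup0 sW)).
  by apply: rk_mono => x [].
exact: (rkb (ltnSn d) (rW d.+1)).
Qed.

End BoundedRank.

(** * Rings of definable endomorphisms *)

Record endo (V : zmodType) := Endo { efun :> V -> V; efunP : zmod_morphism efun }.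

HB.instance Definition _ V := gen_eqMixin (endo V).
HB.instance Definition _ V := gen_choiceMixin (endo V).

Section EndoRing.
Variable V : zmodType.
Implicit Types f g h : endo V.

Lemma endoP f g : f =1 g -> f = g.
Proof.
case: f g => f fP [g gP] /= /funext fg; case: _ / fg in gP *.
by congr Endo; exact: Prop_irrelevance.
Qed.

Lemma endoB f u v : f (u - v) = f u - f v. Proof. exact: efunP. Qed.
Lemma endo0 f : f 0 = 0. Proof. by rewrite -[X in f X](subrr (0 : V)) endoB subrr. Qed.
Lemma endoN f u : f (- u) = - f u. Proof. by rewrite -sub0r endoB endo0 sub0r. Qed.
Lemma endoD f u v : f (u + v) = f u + f v.
Proof. by rewrite -[v in LHS]opprK endoB endoN opprK. Qed.

Fact endo_zero_subproof : zmod_morphism (fun _ : V => 0 : V).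
Proof. by move=> u v; rewrite subrr. Qed.
Fact endo_opp_subproof f : zmod_morphism (fun u => - f u).
Proof. by move=> u v; rewrite endoB opprB opprK addrC. Qed.
Fact endo_add_subproof f g : zmod_morphism (fun u => f u + g u).
Proof. by move=> u v; rewrite !endoB opprD addrACA. Qed.
Fact endo_one_subproof : zmod_morphism (id : V -> V).
Proof. by []. Qed.
Fact endo_mul_subproof f g : zmod_morphism (fun u => f (g u)).
Proof. by move=> u v; rewrite !endoB. Qed.

Definition endo_zero := Endo endo_zero_subproof.
Definition endo_opp f := Endo (endo_opp_subproof f).
Definition endo_add f g := Endo (endo_add_subproof f g).
Definition endo_one := Endo endo_one_subproof.
Definition endo_mul f g := Endo (endo_mul_subproof f g).

Fact endo_addA : associative endo_add.
Proof. by move=> f g h; apply: endoP => u /=; rewrite addrA. Qed.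
Fact endo_addC : commutative endo_add.
Proof. by move=> f g; apply: endoP => u /=; rewrite addrC. Qed.
Fact endo_add0 : left_id endo_zero endo_add.
Proof. by move=> f; apply: endoP => u /=; rewrite add0r. Qed.
Fact endo_addN : left_inverse endo_zero endo_opp endo_add.
Proof. by move=> f; apply: endoP => u /=; rewrite addNr. Qed.
HB.instance Definition _ :=
  GRing.isZmodule.Build (endo V) endo_addA endo_addC endo_add0 endo_addN.

Fact endo_mulA : associative endo_mul. Proof. by move=> f g h; exact: endoP. Qed.
Fact endo_mul1 : left_id endo_one endo_mul. Proof. by move=> f; exact: endoP. Qed.
Fact endo_mulr1 : right_id endo_one endo_mul. Proof. by move=> f; exact: endoP. Qed.
Fact endo_mulDl : left_distributive endo_mul +%R.
Proof. by move=> f g h; exact: endoP. Qed.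
Fact endo_mulDr : right_distributive endo_mul +%R.
Proof. by move=> f g h; apply: endoP => u /=; rewrite endoD. Qed.
HB.instance Definition _ := GRing.Zmodule_isPzRing.Build (endo V)
  endo_mulA endo_mul1 endo_mulr1 endo_mulDl endo_mulDr.

Lemma endo_add_app f g u : (f + g) u = f u + g u. Proof. by []. Qed.
Lemma endo_sub_app f g u : (f - g) u = f u - g u. Proof. by []. Qed.
Lemma endo_mul_app f g u : (f * g) u = f (g u). Proof. by []. Qed.
Lemma endo_muln_app f n u : (f *+ n) u = f u *+ n.
Proof. by elim: n => [|n IH] //; rewrite !mulrS -IH. Qed.

Lemma exponent_endo p : (forall v : V, v *+ p = 0) -> forall f, f *+ p = 0.
Proof. by move=> pV f; apply: endoP => u; rewrite endo_muln_app pV. Qed.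

End EndoRing.

(** Bezout's identity, written in natural numbers as [a * n - c * p = 1]. *)
Lemma mulrn_coprime_eq0 (V : zmodType) (u : V) n p : (0 < n)%N -> coprime n p ->
  u *+ n = 0 -> u *+ p = 0 -> u = 0.
Proof.
move=> n_gt0 /(coprimeP p n_gt0)[[a c] /= ac] un up.
have le_ca : (c * p <= a * n)%N by apply: ltnW; rewrite -subn_gt0 ac.
have : u *+ (a * n - c * p) = u by rewrite ac mulr1n.
by rewrite mulrnBr// (mulnC a) (mulnC c) !mulrnA un up !mul0rn subrr.
Qed.

(** * Frobenius and inner derivations in rings of prime exponent *)

Section RingLemmas.
Variables (R : pzRingType) (p : nat).
Hypotheses (p_prime : prime p) (pR : forall x : R, x *+ p = 0).
Implicit Types x y s : R.

(** The inner binomial coefficients are multiples of [p], so only the two extreme terms of the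
    expansion remain. *)
Lemma expp_addr_comm x y : GRing.comm x y -> (x + y) ^+ p = x ^+ p + y ^+ p.
Proof.
move=> cxy; have p_gt0 := prime_gt0 p_prime.
rewrite exprDn_comm// -(prednK p_gt0) big_ord_recl big_ord_recr /= prednK//.
rewrite subn0 expr0 mulr1 bin0 mulr1n.
rewrite [X in _ + (X + _)]big1 => [|i _]; last first.
  have /dvdnP[k ->] : (p %| 'C(p, bump 0 i))%N.
    apply: prime_dvd_bin => //; rewrite /bump /= add1n.
    by have := ltn_ord i; rewrite -ltnS prednK.
  by rewrite mulrnA pR.
by rewrite add0r /bump /= add1n prednK// subnn expr0 mul1r binn mulr1n.
Qed.

Lemma expp_subr_comm x y : GRing.comm x y -> (x - y) ^+ p = x ^+ p - y ^+ p.
Proof.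
move=> cxy; apply/eqP; rewrite eq_sym subr_eq -expp_addr_comm ?subrK//.
by apply: commr_sym; apply: commrB => //; exact: commr_sym.
Qed.

(** The rule for differentiating a power, for the derivation [[s, -]]; it is valid because [x]
    commutes with its derivative. *)
Lemma commutatorX s x n : GRing.comm x (s * x - x * s) ->
  s * x ^+ n.+1 - x ^+ n.+1 * s = (x ^+ n * (s * x - x * s)) *+ n.+1.
Proof.
set D := s * x - x * s => cxD.
elim: n => [|n IH]; first by rewrite !expr1 expr0 mul1r.
have -> : s * x ^+ n.+2 - x ^+ n.+2 * s =
    D * x ^+ n.+1 + x * (s * x ^+ n.+1 - x ^+ n.+1 * s).
  by rewrite [x ^+ n.+2]exprS mulrBl mulrBr !mulrA addrA subrK.
rewrite IH (commrX n.+1 (commr_sym cxD)) mulrnAr mulrA -exprS.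
by rewrite -mulrS.
Qed.

Lemma commutator_expp s x : GRing.comm x (s * x - x * s) ->
  s * x ^+ p = x ^+ p * s.
Proof.
move=> cxD; apply/eqP; rewrite -subr_eq0 -(prednK (prime_gt0 p_prime)).
by rewrite commutatorX// prednK ?prime_gt0// pR.
Qed.

End RingLemmas.

(** * Definable endomorphisms and definable families of them *)

Section DefinableEndo.
Variables (L : language) (M : fostruct L) (V : dgroup M).
Implicit Types (f g : endo V) (U : set V).

Definition dendo f := @dmap _ _ (dg V) (dg V) f.

Lemma dendo_comp (D : dtype M) f (h : D -> V) : dendo f ->
  @dmap _ _ D (dg V) h -> @dmap _ _ D (dg V) (fun t => f (h t)).
Proof. by move=> df dh; exact: dmap_comp (df : dmap (f : dg V -> dg V)) dh. Qed.

Lemma dendo1 : dendo 1. Proof. exact: dmap_id. Qed.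

Lemma dendoB f g : dendo f -> dendo g -> dendo (f - g).
Proof. exact: dmap_sub. Qed.

Lemma dendoM f g : dendo f -> dendo g -> dendo (f * g).
Proof. exact: dendo_comp. Qed.

Definition stable f U := forall u, U u -> U (f u).

(** Definability is recorded for the elements of [R], not for the set [R]; a definable
    parametrisation is recovered later, in [endo_ring_family]. *)
Record comm_endo_ring (R : set (endo V)) : Prop := CommEndoRing {
  cer1 : R 1;
  cerB : forall f g, R f -> R g -> R (f - g);
  cerM : forall f g, R f -> R g -> R (f * g);
  cerC : forall f g, R f -> R g -> GRing.comm f g;
  cer_dendo : forall f, R f -> dendo f
}.

Lemma cer0 R : comm_endo_ring R -> R 0.
Proof. by move=> cR; rewrite -(subrr 1); apply: cerB => //; exact: cer1. Qed.

Lemma cerN R f : comm_endo_ring R -> R f -> R (- f).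
Proof. by move=> cR Rf; rewrite -sub0r; apply: cerB => //; exact: cer0. Qed.

Lemma cerD R f g : comm_endo_ring R -> R f -> R g -> R (f + g).
Proof. by move=> cR Rf Rg; rewrite -[g]opprK; apply: cerB => //; exact: cerN. Qed.

Lemma cerX R f n : comm_endo_ring R -> R f -> R (f ^+ n).
Proof.
move=> cR Rf; elim: n => [|n IH]; first exact: cer1.
by rewrite exprS; exact: cerM.
Qed.

Lemma additive_endo f U : additive_on U f.
Proof. by move=> u v _ _; exact: endoB. Qed.

Lemma stableX f U n : stable f U -> stable (f ^+ n) U.
Proof. by move=> sf u Uu; elim: n => [//|n IH]; rewrite exprS; exact: sf. Qed.

Lemma endo_image_comp f g U : (f * g) @` U = f @` (g @` U).
Proof.
apply/seteqP; split=> [_ [u Uu <-]|_ [_ [u Uu <-] <-]]; last by exists u.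
by exists (g u) => //; exists u.
Qed.

Lemma cdsub_endo_image f U : cdsub U -> dendo f -> cdsub (f @` U).
Proof. by move=> cU df; apply: cdsub_image => //; exact: additive_endo. Qed.

Definition endo_family (D : dtype M) (g : D -> endo V) :=
  @dmap _ _ (dprod D (dg V)) (dg V) (fun z => g z.1 z.2).

Lemma endo_family_app (D E : dtype M) (g : D -> endo V) (a : E -> D) (h : E -> V) :
  endo_family g -> @dmap _ _ E D a -> @dmap _ _ E (dg V) h ->
  @dmap _ _ E (dg V) (fun t => g (a t) (h t)).
Proof.
move=> dg0 da dh; exact: (dmap_comp (g := fun z : dprod D (dg V) => (g z.1 z.2 : dg V))
  dg0 (dmap_pair da dh)).
Qed.

Lemma endo_family_mul (D : dtype M) f (g : D -> endo V) :
  dendo f -> endo_family g -> endo_family (fun t => f * g t).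
Proof. exact: dendo_comp. Qed.

Lemma endo_family_add (D E : dtype M) (g : D -> endo V) (h : E -> endo V) :
  endo_family g -> endo_family h ->
  endo_family (fun z : dprod D E => g z.1 + h z.2).
Proof.
move=> dg0 dh; apply: dmap_add.
  apply: endo_family_app dg0 _ _; last exact: dmap_proj2.
  exact: dmap_fst (dmap_proj1 _ _).
apply: endo_family_app dh _ _; last exact: dmap_proj2.
exact: dmap_snd (dmap_proj1 _ _).
Qed.

Lemma endo_family_exp (D : dtype M) (g : D -> endo V) n :
  endo_family g -> endo_family (fun t => g t ^+ n).
Proof.
move=> dg0; elim: n => [|n IH]; first exact: dmap_proj2.
suff -> : (fun t => g t ^+ n.+1) = (fun t => g t * g t ^+ n).
  apply: endo_family_app dg0 _ IH; exact: dmap_proj1.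
by apply/funext => t; rewrite exprS.
Qed.

End DefinableEndo.

(** * Commutative rings whose elements are zero or onto *)

Section FieldOfEndomorphisms.
Variables (L : language) (M : fostruct L) (V G : dgroup M) (d : nat).
Hypothesis rkV : ~ rk (D := dg V) d.+1 setT.
Variables (R : set (endo V)) (V1 : set V) (b : G -> endo V).
Hypothesis cR : comm_endo_ring R.
Hypothesis cV1 : cdsub V1.
Hypothesis stR : forall f, R f -> stable f V1.
Hypothesis dichR : forall f, R f -> (forall u, V1 u -> f u = 0) \/ f @` V1 = V1.
Hypothesis cG : connected (dgcode G) setT.
Hypothesis bB : forall x y, b (x - y) = b x - b y.
Hypothesis Rb : forall x, R (b x).
Hypothesis db : endo_family (D := dg G) b.
Hypothesis b_neq0 : exists x, exists2 u, V1 u & b x u <> 0.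

(** The kernel of [f] on [V1] is finite because [f] is onto. It contains every [b x u], as [b x]
    commutes with [f]; so [x |-> b x u] is an additive map from a connected group to a finite set,
    hence zero. *)
Let kernel_family f : R f -> f @` V1 = V1 ->
  forall x u, V1 u -> f u = 0 -> b x u = 0.
Proof.
move=> Rf fV1 x u Vu fu0; have df := cer_dendo cR Rf.
have fin := surjective_kernel rkV cV1.1 df (@additive_endo _ _ _ f V1) fV1.
apply: (@connected_finite_image _ _ G V (fun x => b x u) _ cG _ _ fin) => [|y z|y].
- by apply: endo_family_app db _ _; [exact: dmap_id|exact: dmap_cst].
- by rewrite bB.
- split; first exact: stR.
  by rewrite /preimage /= -endo_mul_app (cerC cR Rf (Rb y)) endo_mul_app fu0 endo0.
Qed.

Lemma endo_ring_injective f u : R f -> V1 u -> u <> 0 -> f u = 0 ->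
  forall v, V1 v -> f v = 0.
Proof.
move=> Rf Vu u0 fu0; have [//|fV1] := dichR Rf.
have [x [w Vw bw]] := b_neq0; case: u0.
have Rx := Rb x.
have [h|bV1] := dichR Rx; first by rewrite h in bw.
have [v Vv bvu] : (b x @` V1) u by rewrite bV1.
(* Here [f] is onto, so [b x] kills its kernel. Writing [u = b x v] gives [(b x)^2 v = 0], and the
   same principle for the onto map [(b x)^2] gives [u = 0]. *)
have bu0 := kernel_family Rf fV1 x Vu fu0.
rewrite -bvu; apply: (@kernel_family (b x * b x)) => //; first exact: cerM.
  by rewrite endo_image_comp !bV1.
by rewrite endo_mul_app bvu.
Qed.

Lemma endo_ring_eq f g u : R f -> R g -> V1 u -> u <> 0 -> f u = g u ->
  forall v, V1 v -> f v = g v.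
Proof.
move=> Rf Rg Vu u0 fg v Vv; apply/eqP; rewrite -subr_eq0 -endo_sub_app; apply/eqP.
apply: endo_ring_injective Vv => //; [exact: cerB|exact: Vu|exact: u0|].
by rewrite endo_sub_app fg subrr.
Qed.

Variable w : V.
Hypotheses (V1w : V1 w) (w0 : w <> 0).

(** Evaluation at [w] is injective on the restrictions of [R] to [V1], so [R] can be measured inside
    [V]. Among the connected subgroups [{g t w}] that come from definable families in [R], a maximal
    one, [U], turns out to be all of [R w]. *)
Lemma endo_ring_family : exists (D : dtype M) (g : D -> endo V),
  [/\ endo_family g, forall t, R (g t), cdsub [set g t w | t in setT] &
      forall f, R f -> exists t, forall u, V1 u -> f u = g t u].
Proof.
pose C : set (set V) := [set U | cdsub U /\ exists (D : dtype M) (g : D -> endo V),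
  [/\ endo_family g, forall t, R (g t) & U = [set g t w | t in setT]]].
have cGT : cdsub [set: G] by split=> //; exact: dsub_setT.
have dbw : @dmap _ _ (dg G) (dg V) (fun x => b x w).
  by apply: endo_family_app db _ _; [exact: dmap_id|exact: dmap_cst].
pose Ub := [set b x w | x in setT].
have cUb : cdsub Ub by apply: cdsub_image => // x y _ _; rewrite bB.
have [U CU maxU] : exists2 U, C U & forall K, C K -> U `<=` K -> K = U.
  apply: cdsub_maximal rkV _ _ _; first by move=> H [].
  by exists Ub; split=> //; exists (dg G), b.
have [cU [D [g [dg0 Rg EU]]]] := CU; have [[sU _] _] := cU.
(* Families can be added, so by maximality [U] contains every competitor. *)
have add U' : C U' -> U' `<=` U.
  move=> [cU' [E [h [dh Rh EU']]]]; have [[sU' _] _] := cU'.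
  suff <- : sumset U U' = U by exact: sumset_subr.
  apply: maxU; last exact: sumset_subl.
  split; first exact: cdsub_sumset.
  exists (dprod D E), (fun z => g z.1 + h z.2); split.
  - exact: endo_family_add.
  - by move=> z; exact: cerD.
  rewrite EU EU'; apply/seteqP; split.
    by move=> _ [_ [_ [[t _ <-] [s _ <-] ->]]]; exists (t, s).
  by move=> _ [[t s] _ <-]; exists (g t w), (h s w); split; [exists t|exists s|].
have UbU : Ub `<=` U by apply: add; split=> //; exists (dg G), b.
have stU f : R f -> stable f U.
  move=> Rf u Uu; apply: (add (f @` U)); last by exists u.
  have df := cer_dendo cR Rf; split; first exact: cdsub_endo_image.
  exists D, (fun t => f * g t); split.
  - exact: endo_family_mul.
  - by move=> t; exact: cerM.
  rewrite EU; apply/seteqP; split=> [_ [_ [t _ <-] <-]|_ [t _ <-]]; first by exists t.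
  by exists (g t w) => //; exists t.
have UV1 : U `<=` V1 by rewrite EU => _ [t _ <-]; exact: stR.
have [x [v Vv bv]] := b_neq0.
have b_inj u : V1 u -> b x u = 0 -> u = 0.
  move=> Vu bu0; apply: contrapT => u0; apply: bv; exact: endo_ring_injective bu0 _ Vv.
have bU : b x @` U = U.
  apply: (injective_image rkV cU (cer_dendo cR (Rb x)) (@additive_endo _ _ _ _ _)).
    exact: stU.
  by move=> u /UV1; exact: b_inj.
(* [b x] is injective on [V1] and maps [U] onto [U], which contains [b x w]; so [w] lies in [U]. *)
have Uw : U w.
  have [u Uu bu] : (b x @` U) (b x w) by rewrite bU; apply: UbU; exists x.
  suff <- : u = w by [].
  apply/eqP; rewrite -subr_eq0; apply/eqP/b_inj; last by rewrite endoB bu subrr.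
  by apply: subgroupB => //; [case: cV1; case|exact: UV1].
exists D, g; split=> //; first by rewrite -EU.
move=> f Rf; have : U (f w) by exact: stU.
rewrite EU => -[t _ gt]; exists t => u Vu; exact: (endo_ring_eq Rf (Rg t) V1w w0 (esym gt)).
Qed.

Let eqX f g n : R f -> R g -> (forall u, V1 u -> f u = g u) ->
  forall u, V1 u -> (f ^+ n) u = (g ^+ n) u.
Proof.
move=> Rf Rg fg u Vu; elim: n => [//|n IH].
by rewrite !exprS !endo_mul_app IH fg//; apply: stableX => //; exact: stR.
Qed.

Lemma endo_ring_reduced f n u : R f -> V1 u -> (f ^+ n) u = 0 -> u <> 0 ->
  forall v, V1 v -> f v = 0.
Proof.
move=> Rf Vu fu0 u0; apply: contrapT => h; apply: u0.
elim: n fu0 => [//|n IH]; rewrite exprS endo_mul_app => ffn; apply: IH.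
apply: contrapT => fn0; apply: h; apply: (endo_ring_injective Rf _ fn0 ffn).
by apply: stableX => //; exact: stR.
Qed.

Variable p : nat.
Hypotheses (p_prime : prime p) (pV : forall v : V, v *+ p = 0).

(** Frobenius is carried to the connected group [U] of values at [w], as [tau] with
    [tau (g w) = g^p w]. It is additive on [U], and injective because a nilpotent element of [R]
    vanishes on [V1]; so [injective_image] makes it onto. *)
Lemma endo_ring_perfect f : R f -> exists2 g, R g & forall u, V1 u -> f u = (g ^+ p) u.
Proof.
have [D [g [dg0 Rg cU gR]]] := endo_ring_family.
set U := [set g t w | t in setT] in cU.
have [[sU dU] _] := cU.
have U_E x : U x <-> exists t, g t w = x.
  by split=> [[t _ <-]|[t <-]]; exists t.
have [c Hc] : {c : V -> D & forall x, U x -> g (c x) w = x}.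
  apply: (@choice _ _ (fun x t => U x -> g t w = x)) => x.
  case: (pselect (U x)) => [[t _ <-]|nU]; first by exists t.
  by have [t _] := gR 0 (cer0 cR); exists t.
(* The value 0 outside [U] is a default that makes [tau] total. *)
pose tau x := if pselect (U x) then (g (c x) ^+ p) w else 0.
have tauE t : tau (g t w) = (g t ^+ p) w.
  rewrite /tau; case: pselect => [Ut|[]]; last by exists t.
  by apply: eqX V1w => //; apply: (endo_ring_eq _ _ V1w w0) => //; exact: Hc.
have dtau : @dmap _ _ (dg V) (dg V) tau.
  apply: dmap_graph.
  (* The graph is written with a quantifier over [t], since the choice function [c] need not be
     definable. *)
  apply: (@dset_ext _ _ (dprod (dg V) (dg V)) [set z |
    (exists t : D, (g t w : dg V) = z.1 /\ ((g t ^+ p) w : dg V) = z.2) \/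
    (~ (exists t : D, (g t w : dg V) = z.1) /\ z.2 = (0 : V))]).
    move=> [x y] /=; split=> [[[t [<- <-]]|[nx ->]]|<-]; first by rewrite tauE.
      by rewrite /tau; case: pselect => // Ux; case/U_E: (Ux) => t tx; case: nx; exists t.
    case: (pselect (exists t, g t w = x)) => [[t <-]|nx].
      by left; exists t; rewrite tauE.
    by right; split=> //; rewrite /tau; case: pselect => // Ux; case: nx; apply/U_E.
  (* Used with [n = 1] for [g t w] itself and with [n = p] for its image under [tau]. *)
  have dgw (E : dtype M) (a : E -> D) n : @dmap _ _ E D a ->
      @dmap _ _ E (dg V) (fun z => (g (a z) ^+ n) w).
    move=> da; apply: endo_family_app (endo_family_exp n dg0) da _.
    exact: dmap_cst.
  apply: dset_or.
    apply: (@dset_ex _ _ (dprod (dg V) (dg V)) D (fun z t =>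
      (g t w : dg V) = z.1 /\ ((g t ^+ p) w : dg V) = z.2)); apply: dset_and.
      apply: dset_eq; first exact: (dgw _ _ 1 (dmap_proj2 _ _)).
      exact: dmap_fst (dmap_proj1 _ _).
    apply: dset_eq; first exact: (dgw _ _ p (dmap_proj2 _ _)).
    exact: dmap_snd (dmap_proj1 _ _).
  apply: dset_and; last first.
    apply: (@dset_eq _ _ (dprod (dg V) (dg V)) (dg V)); first exact: dmap_proj2.
    exact: dmap_cst.
  apply: dset_not; apply: (@dset_ex _ _ (dprod (dg V) (dg V)) D (fun z t =>
      (g t w : dg V) = z.1)).
  apply: dset_eq; first exact: (dgw _ _ 1 (dmap_proj2 _ _)).
  exact: dmap_fst (dmap_proj1 _ _).
have tauU : tau @` U = U.
  apply: (injective_image rkV cU dtau).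
  - move=> x y Ux Uy; have Uxy := subgroupB sU Ux Uy.
    case/U_E: Ux Uy Uxy => t <- /U_E[s <-] /U_E[r rE].
    rewrite -rE !tauE -endo_sub_app -(expp_subr_comm p_prime (exponent_endo pV)).
      apply: eqX V1w => //; first exact: cerB.
      by apply: (endo_ring_eq _ _ V1w w0) => //; exact: cerB.
    exact: (cerC cR (Rg t) (Rg s)).
  - move=> x /U_E[t <-]; rewrite tauE.
    have [s Hs] := gR _ (cerX p cR (Rg t)); by rewrite Hs//; exists s.
  - move=> x /U_E[t <-]; rewrite tauE => gp0.
    exact: (endo_ring_reduced (Rg t) V1w gp0 w0).
move=> Rf; have [t Ht] := gR f Rf.
have : U (f w) by rewrite Ht//; exists t.
rewrite -{1}tauU => -[_ [s _ <-]]; rewrite tauE => gf.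
by exists (g s) => //; apply: (endo_ring_eq _ _ V1w w0) => //; exact: cerX.
Qed.

End FieldOfEndomorphisms.

(** * Operators normalising a commutative ring of endomorphisms *)

Section MinimalStable.
Variables (L : language) (M : fostruct L) (V : dgroup M) (d : nat).
Hypothesis rkV : ~ rk (D := dg V) d.+1 setT.

(** The descending chain condition gives a minimal infinite stable definable subgroup of [V1]. Its
    connected component is again infinite and stable, so the minimal subgroup is connected. *)
Lemma minimal_stable (O : set (endo V)) (V1 : set V) :
  (forall f, O f -> dendo f) -> cdsub V1 -> V1 <> [set 0] ->
  (forall f, O f -> stable f V1) ->
  exists W, [/\ cdsub W, W <> [set 0], W `<=` V1, forall f, O f -> stable f W &
    forall U, cdsub U -> U `<=` W -> (forall f, O f -> stable f U) ->
      U = [set 0] \/ U = W].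
Proof.
move=> dO cV1 V1n0 stO.
pose C : set (set V) := [set U | [/\ dsub U, ~ finite_index [set 0] U, U `<=` V1 &
  forall f, O f -> stable f U]].
have infC U : cdsub U -> U <> [set 0] -> ~ finite_index [set 0] U.
  by move=> cU Un0 fi; apply/Un0/cdsub_finite.
have CV1 : C V1 by split=> //; [case: cV1|exact: infC].
have [H [dH infH HV1 stH] minH] := dsub_minimal rkV
  (fun U (h : C U) => let: And4 h1 _ _ _ := h in h1) (ex_intro _ V1 CV1).
have [K [cK KH Kn0 stK]] := infinite_cdsub rkV dH infH.
have stKO f : O f -> stable f K.
  move=> Of; apply: stK; [exact: dO|exact: additive_endo|exact: stH].
have KE : K = H.
  apply: minH => //; split=> //; [by case: cK|exact: infC|exact: subset_trans KH HV1].
rewrite -{}KE in stH infH minH HV1 *.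
exists K; split=> // U cU UK stU; case: (pselect (U = [set 0])) => [->|Un0]; first by left.
right; apply: minH => //; split=> //; [by case: cU|exact: infC|exact: subset_trans UK HV1].
Qed.

End MinimalStable.

(** * Commutation of a ring with operators that normalise it *)

Section CentralizingOperators.
Variables (L : language) (M : fostruct L) (V G : dgroup M) (d p : nat).
Hypothesis rkV : ~ rk (D := dg V) d.+1 setT.
Hypotheses (p_prime : prime p) (pV : forall v : V, v *+ p = 0) (lt_dp : (d < p)%N).
Variables (R S : set (endo V)) (V1 : set V) (b : G -> endo V).
Hypothesis cR : comm_endo_ring R.
Hypothesis dS : forall s, S s -> dendo s.
Hypothesis SR : forall s f, S s -> R f -> R (s * f - f * s).
Hypothesis cV1 : cdsub V1.
Hypothesis V1n0 : V1 <> [set 0].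
Hypothesis stR : forall f, R f -> stable f V1.
Hypothesis stS : forall s, S s -> stable s V1.
Hypothesis minV1 : forall U, cdsub U -> U `<=` V1 -> (forall f, R f -> stable f U) ->
  (forall s, S s -> stable s U) -> U = [set 0] \/ U = V1.

Let commE (s f : endo V) u : s (f u) = f (s u) + (s * f - f * s) u.
Proof. by rewrite endo_sub_app !endo_mul_app addrC subrK. Qed.

(** * The annihilator of a minimal submodule *)

Section MinimalSubmodule.
Variable W : set V.
Hypotheses (cW : cdsub W) (Wn0 : W <> [set 0]) (WV1 : W `<=` V1).
Hypothesis stW : forall f, R f -> stable f W.
Hypothesis minW : forall U, cdsub U -> U `<=` W -> (forall f, R f -> stable f U) ->
  U = [set 0] \/ U = W.

Definition kills (f : endo V) (U : set V) := forall u, U u -> f u = 0.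

(** Schur's argument: as [R] is commutative, the image of [W] under [f] is a submodule of the
    minimal [W]. *)
Let dichW f : R f -> kills f W \/ f @` W = W.
Proof.
move=> Rf; have cfW : cdsub (f @` W).
  by apply: cdsub_endo_image => //; exact: (cer_dendo cR).
have fWW : f @` W `<=` W by move=> _ [u Wu <-]; exact: stW.
have stfW g : R g -> stable g (f @` W).
  move=> Rg _ [u Wu <-]; exists (g u); first exact: stW.
  by rewrite -!endo_mul_app (cerC cR Rf Rg).
case: (minW cfW fWW stfW) => h; [left|by right].
by move=> u Wu; have : [set 0] (f u) by rewrite -h; exists u.
Qed.

(* A maximal such U is stable under S, hence equal to V1 by irreducibility. *)
Let propagate (Q : set V -> Prop) : Q W ->
  (forall U s, cdsub U -> U `<=` V1 -> W `<=` U -> (forall f, R f -> stable f U) -> S s ->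
    Q U -> Q (sumset U (s @` U))) -> Q V1.
Proof.
move=> QW QS; pose C : set (set V) := [set U | [/\ cdsub U, U `<=` V1, W `<=` U &
  (forall f, R f -> stable f U) /\ Q U]].
have [U [cU UV1 WU [stU QU]] maxU] := cdsub_maximal rkV
  (fun U (h : C U) => let: And4 h1 _ _ _ := h in h1)
  (ex_intro _ W (And4 cW WV1 (@subset_refl _ W) (conj stW QW))).
suff stSU s : S s -> stable s U.
  have [U0|UE] := minV1 cU UV1 stU stSU; last by rewrite -UE.
  case: Wn0; apply/seteqP; split; first by rewrite -U0.
  by move=> _ ->; apply: subgroup0; case: cW; case.
move=> Ss; have csU : cdsub (s @` U) by apply: cdsub_endo_image => //; exact: dS.
have [[sU _] _] := cU; have [[ssU _] _] := csU.
suff CUs : C (sumset U (s @` U)).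
  move=> u Uu; rewrite -(maxU _ CUs); last exact: sumset_subl.
  by apply: sumset_subr => //; exists u.
split.
- exact: cdsub_sumset.
- apply: sumset_min => //; first by case: cV1; case.
  by move=> _ [u /UV1 Vu <-]; exact: stS.
- exact: subset_trans WU (sumset_subl ssU).
- split; last exact: QS.
  move=> f Rf _ [a [_ [Ua [u Uu <-] ->]]].
  (* The product rule regroups [f (a + s u)] as [(f a - [s, f] u) + s (f u)]. *)
  exists (f a - (s * f - f * s) u), (s (f u)); split.
  + by apply: subgroupB => //; [exact: stU|apply: stU => //; exact: SR].
  + by exists (f u) => //; exact: stU.
  + by rewrite endoD (commE s f u) addrA [in RHS]addrAC subrK.
Qed.

(** If [j^n] kills [U], then [j^n (s u) = - [s, j^n] u] lies in [U], so [j^(n+n)] kills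
    [U + s U]. *)
Let nilpotent_on j : R j -> kills j W -> exists n, kills (j ^+ n) V1.
Proof.
move=> Rj jW; apply: (@propagate (fun U => exists n, kills (j ^+ n) U)).
  by exists 1%N.
move=> U s cU UV1 WU stU Ss [n jU]; exists (n + n)%N => _ [a [_ [Ua [u Uu <-] ->]]].
have Rn := cerX n cR Rj.
rewrite endoD exprD !endo_mul_app (jU a Ua) endo0 add0r.
have -> : (j ^+ n) (s u) = - (s * j ^+ n - j ^+ n * s) u.
  by rewrite endo_sub_app !endo_mul_app (jU u Uu) endo0 sub0r opprK.
by rewrite endoN jU ?oppr0//; apply: stU => //; exact: SR.
Qed.

(** For the least such [n], the images of [V1] under [j^0, ..., j^n] strictly decrease: otherwise
    they would be constant from some [i < n] on, and [j^i] would kill [V1]. They are connected, so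
    [cdsub_chain] applies. *)
Let nilpotent_bound j : R j -> kills j W -> exists2 n, (n <= d)%N & kills (j ^+ n) V1.
Proof.
move=> Rj jW; have [m jm] := nilpotent_on Rj jW.
have ex : exists n, `[< kills (j ^+ n) V1 >] by exists m; apply/asboolP.
case: (ex_minnP ex) => n /asboolP jn minn; exists n => //.
pose X i := (j ^+ i) @` V1.
apply: (@cdsub_chain _ _ V d rkV n X).
  by move=> i; apply: cdsub_endo_image => //; apply: (cer_dendo cR); exact: cerX.
have XS i : X i.+1 = j @` X i by rewrite /X exprS endo_image_comp.
have X0 i k : X i.+1 = X i -> X (i + k)%N = X i.
  by move=> h; elim: k => [|k IH]; rewrite ?addn0// addnS XS IH -XS.
move=> i lt_in; split.
  move=> _ [u Vu <-]; exists (j u); first exact: stR.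
  by rewrite -endo_mul_app -exprSr.
move=> /(X0 i (n - i)%N); rewrite subnKC 1?ltnW// => XnE.
suff : (n <= i)%N by rewrite leqNgt lt_in.
apply: minn; apply/asboolP => u Vu.
have [v Vv <-] : X n ((j ^+ i) u) by rewrite XnE; exists u.
exact: jn.
Qed.

Let killsS f s : S s -> kills f V1 -> kills (s * f - f * s) V1.
Proof.
move=> Ss fV u Vu; rewrite endo_sub_app !endo_mul_app (fV u)// endo0 fV ?subr0//.
exact: stS.
Qed.

Let killsM f g : R g -> kills f V1 -> kills (f * g) V1.
Proof. by move=> Rg fV u Vu; rewrite endo_mul_app fV//; exact: stR. Qed.

Let kills_muln f n : (0 < n < p)%N -> kills (f *+ n) V1 -> kills f V1.
Proof.
move=> /andP[n_gt0 lt_np] h u Vu; apply: (mulrn_coprime_eq0 n_gt0 _ _ (pV (f u))).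
  by rewrite coprime_sym prime_coprime// gtnNdvd.
by rewrite -endo_muln_app; exact: h.
Qed.

(* Differentiating [j ^+ m.+1 * D j ^+ e = 0] and multiplying by [D j] gives
   [m.+1 * j ^+ m * D j ^+ e.+2 = 0]; iterating, [D j] is nilpotent. *)
Let derivation_nilpotent j s n : R j -> S s -> (n < p)%N -> kills (j ^+ n) V1 ->
  exists e, kills ((s * j - j * s) ^+ e) V1.
Proof.
move=> Rj Ss lt_np jn; set g := s * j - j * s; have Rg : R g by exact: SR.
(* Each differentiation trades one factor [j] for two factors [g]; at [k = n] only [g^(2n)] is
   left. *)
suff h k : (k <= n)%N -> kills (j ^+ (n - k) * g ^+ k.*2) V1.
  by exists n.*2; have := h n (leqnn n); rewrite subnn expr0 mul1r.
elim: k => [_|k IH lt_kn]; first by rewrite subn0 expr0 mulr1.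
have := IH (ltnW lt_kn); rewrite -(subnSK lt_kn); set m := (n - k.+1)%N; set e := k.*2.
move=> h0; pose g2 := s * g - g * s; have Rg2 : R g2 by exact: SR.
have comm x y : R x -> R y -> x * y = y * x by move=> Rx Ry; exact: (cerC cR Rx Ry).
have Rjm i : R (j ^+ i) by exact: cerX.
have Rgi i : R (g ^+ i) by exact: cerX.
(* The extra factor [g] turns [e g^(e-1)] into [e g^e], so that the second term of the product rule
   stays a multiple of [j^(m+1) g^e], which kills [V1]. *)
have De : (s * g ^+ e - g ^+ e * s) * g = (g ^+ e * g2) *+ e.
  case: {h0} e => [|e]; first by rewrite expr0 mulr1 mul1r subrr mul0r.
  rewrite commutatorX; last exact: (cerC cR Rg Rg2).
  by rewrite mulrnAl -mulrA (comm g2 g)// mulrA -exprSr.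
have Dj : s * j ^+ m.+1 - j ^+ m.+1 * s = (j ^+ m * g) *+ m.+1.
  by rewrite commutatorX//; exact: (cerC cR Rj Rg).
have h1 := killsM Rg (killsS Ss h0).
have : (s * (j ^+ m.+1 * g ^+ e) - j ^+ m.+1 * g ^+ e * s) * g =
   (j ^+ m * g ^+ e.+2) *+ m.+1 + (j ^+ m.+1 * g ^+ e * g2) *+ e.
  have -> : s * (j ^+ m.+1 * g ^+ e) - j ^+ m.+1 * g ^+ e * s =
     (s * j ^+ m.+1 - j ^+ m.+1 * s) * g ^+ e + j ^+ m.+1 * (s * g ^+ e - g ^+ e * s).
    by rewrite mulrBl mulrBr !mulrA addrA subrK.
  rewrite mulrDl -[X in _ + X]mulrA De mulrnAr mulrA; congr (_ + _).
  by rewrite Dj !mulrnAl -!mulrA -exprSr -exprS.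
(* Here [m + 1 <= n < p], so the coefficient can be cancelled. *)
move=> E; rewrite E in h1; apply: (@kills_muln _ m.+1).
  by rewrite /=; apply: leq_ltn_trans lt_np; rewrite /m subnSK// leq_subr.
move=> u Vu; have := h1 u Vu; rewrite endo_add_app => h2.
have h3 : ((j ^+ m.+1 * g ^+ e * g2) *+ e) u = 0.
  by rewrite endo_muln_app (killsM Rg2 h0)// mul0rn.
by move: h2; rewrite h3 addr0.
Qed.

(** [f] is nilpotent on [V1] with exponent below [p], so [[s, f]] is nilpotent too. It cannot map
    the nonzero group [W] onto itself, so it vanishes on [W] by [dichW]. *)
Let kills_stable f s : R f -> S s -> kills f W -> kills (s * f - f * s) W.
Proof.
move=> Rf Ss fW; have [n le_nd fn] := nilpotent_bound Rf fW.
have [e ge] := derivation_nilpotent Rf Ss (leq_ltn_trans le_nd lt_dp) fn.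
have [//|gW] := dichW (SR Ss Rf).
have h i : ((s * f - f * s) ^+ i) @` W = W.
  elim: i => [|i IH]; last by rewrite exprS endo_image_comp IH.
  by apply/seteqP; split=> [_ [u Wu <-]//|u Wu]; exists u.
case: Wn0; rewrite -(h e); apply/seteqP; split.
  by move=> _ [u Wu <-]; apply: ge; exact: WV1.
move=> _ ->; exists 0; last exact: endo0.
by apply: subgroup0; case: cW; case.
Qed.

(** Each alternative of [dichW] is transported from [W] to [V1] by [propagate]. *)
Lemma submodule_dichotomy f : R f -> kills f V1 \/ f @` V1 = V1.
Proof.
(* The propagated property concerns all of [R] at once: [i (s u) = - [s, i] u], and [[s, i]] again
   kills [W], hence [U]. *)
have killed : forall j, R j -> kills j W -> kills j V1.
  move=> j Rj jW; apply: (@propagate (fun U => forall j, R j -> kills j W -> kills j U)) => //.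
  move=> U s _ _ _ stU Ss QU i Ri iW _ [a [_ [Ua [u Uu <-] ->]]].
  rewrite endoD (QU i Ri iW a Ua) add0r.
  have -> : i (s u) = - (s * i - i * s) u.
    by rewrite endo_sub_app !endo_mul_app (QU i Ri iW u Uu) endo0 sub0r opprK.
  by rewrite (QU (s * i - i * s)) ?oppr0//; [exact: SR|exact: kills_stable].
move=> Rf; have [fW|fW] := dichW Rf; first by left; exact: killed.
right; move: f Rf fW.
apply: (@propagate (fun U => forall f, R f -> f @` W = W -> f @` U = U)) => //.
move=> U s cU _ _ stU Ss QU f Rf fW; have fU := QU f Rf fW.
have [[sU _] _] := cU.
apply/seteqP; split.
  move=> _ [_ [a [_ [Ua [u Uu <-] ->]]] <-].
  exists (f a - (s * f - f * s) u), (s (f u)); split.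
  - by apply: subgroupB => //; [exact: stU|apply: stU => //; exact: SR].
  - by exists (f u) => //; exact: stU.
  - by rewrite endoD (commE s f u) addrA [in RHS]addrAC subrK.
move=> _ [a [_ [Ua [u Uu <-] ->]]].
(* A preimage of [a + s u] is [a' + s u'], where [f u' = u] and [f a' = a + [s, f] u']. *)
have [u' Uu' fu'] : (f @` U) u by rewrite fU.
have [a' Ua' fa'] : (f @` U) (a + (s * f - f * s) u').
  by rewrite fU; apply: subgroupD => //; apply: stU => //; exact: SR.
exists (a' + s u'); first by exists a', (s u'); split=> //; exists u'.
by rewrite endoD fa' -fu' (commE s f u') -addrA; congr (_ + _); exact: addrC.
Qed.

End MinimalSubmodule.

Hypothesis cG : connected (dgcode G) setT.
Hypothesis bB : forall x y, b (x - y) = b x - b y.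
Hypothesis Rb : forall x, R (b x).
Hypothesis db : endo_family (D := dg G) b.
Hypothesis b_neq0 : exists x, exists2 u, V1 u & b x u <> 0.

(** On [V1], [f] agrees with some [g^p], and the derivation [[s, -]] kills [p]-th powers. *)
Lemma operators_centralize s f u : S s -> R f -> V1 u -> s (f u) = f (s u).
Proof.
move=> Ss Rf Vu.
have [W [cW Wn0 WV1 stW minW]] := minimal_stable rkV (cer_dendo cR) cV1 V1n0 stR.
have dich : forall f, R f -> (forall u, V1 u -> f u = 0) \/ f @` V1 = V1.
  exact: submodule_dichotomy cW Wn0 WV1 stW minW.
have [w Vw w0] : exists2 w, V1 w & w <> 0.
  apply: contrapT => h; apply: V1n0; apply/seteqP; split=> [v Vv|_ ->].
    by apply: contrapT => v0; apply: h; exists v.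
  by apply: subgroup0; case: cV1; case.
have [g Rg fg] := endo_ring_perfect rkV cR cV1 stR dich cG bB Rb db b_neq0 Vw w0
  p_prime pV Rf.
have sgp := commutator_expp p_prime (exponent_endo pV) (cerC cR Rg (SR Ss Rg)).
rewrite (fg u Vu) (fg (s u) (stS Ss Vu)).
by have := congr1 (fun h : endo V => h u) sgp.
Qed.

End CentralizingOperators.

(** * Lie rings and their irreducible modules *)

Inductive ring_gen (V : zmodType) (A : set (endo V)) : endo V -> Prop :=
| RingGen1 : ring_gen A 1
| RingGenIn f : A f -> ring_gen A f
| RingGenB f g : ring_gen A f -> ring_gen A g -> ring_gen A (f - g)
| RingGenM f g : ring_gen A f -> ring_gen A g -> ring_gen A (f * g).

(** * The ring generated by a set of endomorphisms *)

Section GeneratedRing.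
Variables (L : language) (M : fostruct L) (V : dgroup M) (A : set (endo V)).

Lemma ring_gen0 : ring_gen A 0.
Proof. by rewrite -(subrr 1); apply: RingGenB; exact: RingGen1. Qed.

Lemma ring_genD f g : ring_gen A f -> ring_gen A g -> ring_gen A (f + g).
Proof.
move=> Rf Rg; rewrite -[g]opprK -[- g]sub0r; apply: RingGenB => //.
by apply: RingGenB => //; exact: ring_gen0.
Qed.

Lemma ring_gen_comm_endo_ring : (forall f, A f -> dendo f) ->
  (forall f g, A f -> A g -> GRing.comm f g) -> comm_endo_ring (ring_gen A).
Proof.
move=> dA cA.
have comm1 f g : A f -> ring_gen A g -> GRing.comm f g.
  move=> Af; elim=> [|h Ah|h k _ IH _ IH'|h k _ IH _ IH'].
  - exact: commr1.
  - exact: cA.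
  - exact: commrB.
  - exact: commrM.
split.
- exact: RingGen1.
- exact: RingGenB.
- exact: RingGenM.
- move=> f g Rf Rg; elim: Rf => [|h Ah|h k _ IH _ IH'|h k _ IH _ IH'].
  + exact/commr_sym/commr1.
  + exact: comm1.
  + by apply/commr_sym/commrB; exact: commr_sym.
  + by apply/commr_sym/commrM; exact: commr_sym.
- move=> f; elim=> [|h Ah|h k _ IH _ IH'|h k _ IH _ IH'].
  + exact: dendo1.
  + exact: dA.
  + exact: dendoB.
  + exact: dendoM.
Qed.

(** By the product rule it is enough to differentiate the generators. *)
Lemma ring_gen_commutator s : (forall a, A a -> ring_gen A (s * a - a * s)) ->
  forall f, ring_gen A f -> ring_gen A (s * f - f * s).
Proof.
move=> h f; elim=> [|a /h//|a c _ IH _ IH'|a c Ra IH Rc IH'].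
- by rewrite mulr1 mul1r subrr; exact: ring_gen0.
- have -> : s * (a - c) - (a - c) * s = (s * a - a * s) - (s * c - c * s).
    rewrite mulrBr mulrBl !opprB addrACA [RHS]addrACA; congr (_ + _); exact: addrC.
  exact: RingGenB.
- have -> : s * (a * c) - a * c * s = (s * a - a * s) * c + a * (s * c - c * s).
    by rewrite mulrBl mulrBr !mulrA addrA subrK.
  by apply: ring_genD; exact: RingGenM.
Qed.

End GeneratedRing.

(** The field is built on the type of [V] itself, so that the isomorphism with its additive group is
    the identity. With the laws bundled, the alias [field_of] can carry the structure. *)
Record field_law (V : zmodType) := FieldLaw {
  fl_mul : V -> V -> V;
  fl_one : V;
  fl_inv : V -> V;
  fl_mulA : associative fl_mul;
  fl_mulC : commutative fl_mul;
  fl_mul1 : left_id fl_one fl_mul;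
  fl_mulDl : left_distributive fl_mul +%R;
  fl_one_neq0 : fl_one != 0;
  fl_mulV : forall x, x != 0 -> fl_mul (fl_inv x) x = fl_one;
  fl_inv0 : fl_inv 0 = 0
}.

Definition field_of (V : zmodType) (F : field_law V) : Type := V.

HB.instance Definition _ V F := GRing.Zmodule.on (@field_of V F).
HB.instance Definition _ V F := GRing.Zmodule_isComNzRing.Build (@field_of V F)
  (fl_mulA F) (fl_mulC F) (fl_mul1 F) (fl_mulDl F) (fl_one_neq0 F).
HB.instance Definition _ V F := GRing.ComNzRing_isField.Build (@field_of V F)
  (fl_mulV F) (fl_inv0 F).

(** * Ideals and the derived series of a Lie ring *)

Section LieRings.
Variables (g : zmodType) (br : g -> g -> g).
Hypothesis lie : lie_ring br.

Lemma lie_brB x y z : br x (y - z) = br x y - br x z.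
Proof. by case: lie => h _ _ _; exact: h. Qed.
Lemma lie_brBl x y z : br (x - y) z = br x z - br y z.
Proof. by case: lie => _ h _ _; exact: (h z). Qed.
Lemma lie_brxx x : br x x = 0. Proof. by case: lie. Qed.
Lemma lie_br0 x : br x 0 = 0.
Proof. by rewrite -[X in br x X](subrr (0 : g)) lie_brB subrr. Qed.
Lemma lie_brN x y : br x (- y) = - br x y.
Proof. by rewrite -sub0r lie_brB lie_br0 sub0r. Qed.

Lemma lie_brC x y : br x y = - br y x.
Proof.
have := lie_brxx (x - y); rewrite lie_brB !lie_brBl !lie_brxx sub0r subr0.
by move/eqP; rewrite -opprD oppr_eq0 addrC addr_eq0 => /eqP.
Qed.

Lemma lie_jacobi x a c : br x (br a c) = br (br x a) c + br a (br x c).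
Proof.
case: lie => _ _ _ /(_ x a c) /eqP; rewrite -addrA addr_eq0 => /eqP ->.
rewrite (lie_brC c (br x a)) (lie_brC c x) lie_brN opprD !opprK.
by rewrite addrC.
Qed.

(** Sets that are merely closed under brackets qualify, such as the center together with one element
    whose brackets are all central. *)
Definition lie_ideal (A : set g) := forall x u, A u -> A (br x u).

Definition lie_center : set g := [set z | forall x, br x z = 0].

Lemma smallest_subgroup (X : set g) :
  subgroup (smallest (fun H : set g => zmod_closed (mem H)) X).
Proof.
apply/subgroupP; split.
  by move=> H [/(subgroup0 (H := H))].
by move=> u v Hu Hv H [sH XH]; apply: (@subgroupB _ H) => //; [exact: Hu|exact: Hv].
Qed.

Lemma lie_ideal_commutator (A B : set g) : lie_ideal A -> lie_ideal B ->
  lie_ideal (lie_commutator br A B).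
Proof.
move=> iA iB x u; set C := lie_commutator br A B.
have sC : subgroup C by exact: smallest_subgroup.
have brC a c : A a -> B c -> C (br a c).
  by move=> Aa Bc H [_]; apply; exists a => //; exists c.
move=> Cu; suff [] : C u /\ C (br x u) by [].
(* The commutator is an intersection of subgroups, so it is compared with the subgroup of those [u]
   in [C] for which [br x u] is in [C]. *)
suff : [set u | C u /\ C (br x u)] u by [].
apply: Cu; split.
  apply/subgroupP; split; first by split; rewrite ?lie_br0; exact: (subgroup0 sC).
  by move=> v v' [? ?] [? ?]; split; rewrite ?lie_brB; exact: (subgroupB sC).
move=> _ [a Aa [c Bc <-]]; split; first exact: brC.
by rewrite lie_jacobi; apply: (subgroupD sC); apply: brC => //; [exact: iA|exact: iB].
Qed.

Lemma lie_ideal_derived n : lie_ideal (lie_derived br n).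
Proof. by elim: n => [//|n IH]; exact: lie_ideal_commutator. Qed.

Lemma lie_derivedS n u v : lie_derived br n u -> lie_derived br n v ->
  lie_derived br n.+1 (br u v).
Proof. by move=> Du Dv H [_ XH]; apply: XH; exists u => //; exists v. Qed.

Lemma lie_abelianP : (forall x y, br x y = 0) -> lie_abelian br.
Proof.
move=> br0; apply/seteqP; split.
  move=> u /(_ [set 0]); apply; split; first exact: subgroup_set0.
  by move=> _ [x _ [y _ <-]]; rewrite br0.
by move=> _ ->; apply: subgroup0; exact: smallest_subgroup.
Qed.

End LieRings.

(** * Faithful irreducible modules of prime exponent *)

Section IrreducibleModules.
Variables (L : language) (M : fostruct L) (G V : dgroup M) (br : G -> G -> G).
Variables (act : G -> endo V) (d p : nat).
Hypothesis rkV : ~ rk (D := dg V) d.+1 setT.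
Hypotheses (p_prime : prime p) (pV : forall v : V, v *+ p = 0) (lt_dp : (d < p)%N).
Hypothesis lie : lie_ring br.
Hypothesis dbr : @dmap _ _ (dprod (dg G) (dg G)) (dg G) (fun z => br z.1 z.2).
Hypothesis cG : connected (dgcode G) setT.
Hypothesis cV : connected (dgcode V) setT.
Hypothesis actB : forall x y, act (x - y) = act x - act y.
Hypothesis act_br : forall x y, act (br x y) = act x * act y - act y * act x.
Hypothesis act_inj : injective act.
Hypothesis dact : endo_family (D := dg G) act.
Hypothesis irr : forall U : set V, cdsub U -> (forall x, stable (act x) U) ->
  U = [set 0] \/ U = setT.
Hypothesis G_neq0 : exists x : G, x != 0.

Let dmap_br (D : dtype M) (f h : D -> G) :
  @dmap _ _ D (dg G) f -> @dmap _ _ D (dg G) h ->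
  @dmap _ _ D (dg G) (fun t => br (f t) (h t)).
Proof.
move=> df dh; exact: (dmap_comp (g := fun z : dprod (dg G) (dg G) => (br z.1 z.2 : dg G))
  dbr (dmap_pair df dh)).
Qed.

Let cVT : cdsub [set: V]. Proof. by split=> //; exact: dsub_setT. Qed.

Let act0 : act 0 = 0.
Proof. by rewrite -[X in act X](subrr (0 : G)) actB subrr. Qed.

Let dendo_act x : dendo (act x).
Proof. by apply: endo_family_app dact _ _; [exact: dmap_cst|exact: dmap_id]. Qed.

Let act_eq0 x : (forall u, act x u = 0) -> x = 0.
Proof. by move=> h; apply: act_inj; rewrite act0; exact: endoP. Qed.

Let V_neq0 : [set: V] <> [set 0].
Proof.
move=> V0; have [x /eqP x0] := G_neq0; apply/x0/act_eq0 => u.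
by have : [set: V] (act x u) by []; rewrite V0.
Qed.

Let exists_neq0 (U : set V) : subgroup U -> U <> [set 0] -> exists2 u, U u & u <> 0.
Proof.
move=> sU Un0; apply: contrapT => h; apply: Un0; apply/seteqP; split=> [v Vv|_ ->].
  by apply: contrapT => v0; apply: h; exists v.
exact: subgroup0.
Qed.

(** If [z] killed [U], its kernel would be infinite. This kernel is invariant as [z] is central, so
    its connected component would be [V] by irreducibility, against faithfulness. *)
Lemma central_act_neq0 z (U : set V) : lie_center br z -> z <> 0 -> cdsub U ->
  U <> [set 0] -> exists2 u, U u & act z u <> 0.
Proof.
move=> Zz z0 cU Un0; apply: contrapT => h.
pose K : set V := setT `&` act z @^-1` [set 0].
have dK : dsub K.
  apply: (@dsub_preim _ _ V V setT [set 0] (act z)); first exact: dsub_setT.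
  - exact: dsub_set0.
  - exact: dendo_act.
  - exact: additive_endo.
have UK : U `<=` K.
  by move=> u Uu; split=> //; apply: contrapT => zu; apply: h; exists u.
have infK : ~ finite_index [set 0] K.
  by move=> /(finite_index_subr UK) fi; apply: Un0; exact: cdsub_finite.
have [K0 [cK0 K0K K0n0 stK0]] := infinite_cdsub rkV dK infK.
have stK x : stable (act x) K.
  move=> u [_ zu]; split=> //; rewrite /preimage /= in zu *.
  have := congr1 (fun f : endo V => f u) (act_br x z).
  by rewrite Zz act0 endo_sub_app !endo_mul_app zu endo0 sub0r => /esym/eqP;
    rewrite oppr_eq0 => /eqP.
have [|//|K0T] := irr cK0 _.
  by move=> x; apply: stK0; [exact: dendo_act|exact: additive_endo|exact: stK].
apply/z0/act_eq0 => u; have K0u : K0 u by rewrite K0T.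
by have [_] := K0K u K0u.
Qed.

Let act_comm x y : br x y = 0 -> GRing.comm (act x) (act y).
Proof.
by move=> xy0; have := act_br x y; rewrite xy0 act0 => /esym/eqP; rewrite subr_eq0 => /eqP.
Qed.

Lemma abelian_ideal_central (A : set G) : lie_ideal br A ->
  (forall a c, A a -> A c -> br a c = 0) -> A `<=` lie_center br.
Proof.
move=> iA abA a Aa x; apply: contrapT => xa0.
pose R := ring_gen (act @` A); pose S := range act.
have cR : comm_endo_ring R.
  apply: ring_gen_comm_endo_ring; first by move=> _ [c _ <-]; exact: dendo_act.
  by move=> _ _ [c Ac <-] [e Ae <-]; apply: act_comm; exact: abA.
have dS s : S s -> dendo s by move=> [y _ <-]; exact: dendo_act.
have SR s f : S s -> R f -> R (s * f - f * s).
  move=> [y _ <-]; apply: ring_gen_commutator => _ [c Ac <-].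
  by rewrite -act_br; apply: RingGenIn; exists (br y c) => //; exact: iA.
have stT (f : endo V) : stable f setT by [].
have minT U : cdsub U -> U `<=` setT -> (forall f, R f -> stable f U) ->
    (forall s, S s -> stable s U) -> U = [set 0] \/ U = setT.
  by move=> cU _ _ stU; apply: irr => // y; apply: stU; exists y.
(* A connected family in [R], nonzero at [x] because [[x, a]] is nonzero and the action is
   faithful. *)
pose b y := act (br y a).
have bB y z : b (y - z) = b y - b z by rewrite /b lie_brBl// actB.
have Rb y : R (b y) by apply: RingGenIn; exists (br y a) => //; exact: iA.
have db : endo_family (D := dg G) b.
  apply: (endo_family_app (E := dprod (dg G) (dg V)) (D := dg G) (a := fun z => br z.1 a) dact).
    by apply: dmap_br; [exact: dmap_proj1|exact: dmap_cst].
  exact: dmap_proj2.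
have bn0 : exists y, exists2 u, setT u & b y u <> 0.
  exists x; apply: contrapT => h; apply/xa0/act_eq0 => u.
  by apply: contrapT => h'; apply: h; exists u.
apply/xa0/act_eq0 => u; rewrite act_br endo_sub_app !endo_mul_app.
rewrite (operators_centralize rkV p_prime pV lt_dp cR dS SR cVT V_neq0 _ _ minT cG
  bB Rb db bn0 (s := act x) (f := act a) (u := u)) ?subrr//; first by exists x.
by apply: RingGenIn; exists a.
Qed.

Lemma nilpotent_ideal_central (B : set G) : lie_ideal br B ->
  (forall u v, B u -> B v -> lie_center br (br u v)) -> B `<=` lie_center br.
Proof.
move=> iB BBZ y By; set Z := lie_center br in BBZ *.
have br_Z z x : Z z -> br z x = 0 by move=> Zz; rewrite lie_brC// Zz oppr0.
have abZ v a c : ([set v] `|` Z) a -> ([set v] `|` Z) c -> br a c = 0.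
  move=> [->|Za]; last by move=> _; exact: br_Z.
  by move=> [->|Zc]; [exact: lie_brxx|exact: Zc].
(* The center of [B] is an abelian ideal of the whole ring. *)
have cZB : [set u | B u /\ forall v, B v -> br u v = 0] `<=` Z.
  apply: abelian_ideal_central => [x u [Bu uB]|u v [Bu uB] [Bv _]]; last exact: uB.
  split=> [|v Bv]; first exact: iB.
  have := lie_jacobi lie x u v; rewrite uB// lie_br0// uB; last exact: iB.
  by rewrite addr0 => <-.
apply: contrapT => nZy.
(* Otherwise every [[s, y]] lies in the center of [B], hence in [Z]; then [y] and [Z] form an
   abelian ideal, and [y] is central. *)
have [s0 [x0 [Bx0 c0]]] : exists s x, B x /\ br (br s y) x <> 0.
  apply: contrapT => h; apply: nZy.
  have brsy s : Z (br s y).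
    apply: cZB; split=> [|v Bv]; first exact: iB.
    by apply: contrapT => h'; apply: h; exists s, v.
  apply: (@abelian_ideal_central ([set y] `|` Z)); last by left.
    by move=> x _ [->|/(_ x) ->]; right => //; move=> v; rewrite lie_br0.
  exact: abZ.
pose t := br s0 y; set c := br t x0 in c0.
have Bt : B t by exact: iB.
have Zc : Z c by exact: BBZ.
pose R := ring_gen (act @` ([set x0] `|` Z)); pose S := [set act t].
have cR : comm_endo_ring R.
  apply: ring_gen_comm_endo_ring; first by move=> _ [a _ <-]; exact: dendo_act.
  move=> _ _ [a Aa <-] [e Ae <-]; apply: act_comm.
  exact: abZ Aa Ae.
have dS s : S s -> dendo s by move=> ->; exact: dendo_act.
have RZ z : Z z -> R (act z) by move=> Zz; apply: RingGenIn; exists z => //; right.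
(* [[t, x0]] is central and brackets with [Z] vanish, so the derivation sends the generators into
   the image of [Z]. *)
have SR s f : S s -> R f -> R (s * f - f * s).
  move=> ->; apply: ring_gen_commutator => _ [a Aa <-]; rewrite -act_br.
  by apply: RZ; case: Aa => [->//|Za]; rewrite Za => v; rewrite lie_br0.
(* [V] need not be irreducible under [R] and [t] alone, hence the passage to a minimal [V1]. *)
have [V1 [cV1 V1n0 _ stV1 minV1]] := @minimal_stable _ _ V d rkV (R `|` S) setT
  (fun f h => match h with or_introl h => cer_dendo cR h | or_intror h => dS _ h end)
  cVT V_neq0 (fun _ _ _ _ => I).
have stR f : R f -> stable f V1 by move=> Rf; apply: stV1; left.
have stS s : S s -> stable s V1 by move=> Ss; apply: stV1; right.
have min U : cdsub U -> U `<=` V1 -> (forall f, R f -> stable f U) ->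
    (forall s, S s -> stable s U) -> U = [set 0] \/ U = V1.
  by move=> cU UV1 hR hS; apply: minV1 => // f [/hR|/hS].
(* [t] has the form [[s0, y]] so that [c] occurs in this family of central elements, indexed by the
   connected ring. *)
pose b s := act (br (br s y) x0).
have bB s s' : b (s - s') = b s - b s' by rewrite /b !lie_brBl// actB.
have Rb s : R (b s) by apply/RZ/BBZ => //; exact: iB.
have db : endo_family (D := dg G) b.
  apply: (endo_family_app (E := dprod (dg G) (dg V)) (D := dg G)
    (a := fun z => br (br z.1 y) x0) dact); last exact: dmap_proj2.
  apply: dmap_br; last exact: dmap_cst.
  by apply: dmap_br; [exact: dmap_proj1|exact: dmap_cst].
have [u Vu cu] := central_act_neq0 Zc c0 cV1 V1n0.
have bn0 : exists s, exists2 u, V1 u & b s u <> 0 by exists s0, u.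
apply: cu; rewrite act_br endo_sub_app !endo_mul_app.
rewrite (operators_centralize rkV p_prime pV lt_dp cR dS SR cV1 V1n0 stR stS min cG
  bB Rb db bn0 (s := act t) (f := act x0) (u := u)) ?subrr//.
by apply: RingGenIn; exists x0 => //; left.
Qed.

(** Centrality climbs the derived series: if the term of index [n.+1] is central,
    [nilpotent_ideal_central] applies to the term of index [n]. *)
Lemma soluble_abelian : lie_soluble br -> forall x y, br x y = 0.
Proof.
move=> [n Dn]; suff h : lie_derived br 0 `<=` lie_center br.
  by move=> x y; exact: h.
have : lie_derived br n `<=` lie_center br.
  by rewrite Dn => _ -> x; rewrite lie_br0.
elim: n {Dn} => // n IH h; apply: IH; apply: nilpotent_ideal_central.
  exact: lie_ideal_derived.
by move=> u v Du Dv; apply: h; exact: lie_derivedS.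
Qed.

Hypothesis br0 : forall x y, br x y = 0.

(** The ring generated by the action is a field whose nonzero elements act simply transitively on
    nonzero vectors. Fixing [w <> 0] transports its product to [V], with [w] as unit. *)
Lemma abelian_linear : exists (K : fieldType) (cK : code M K) (i : V -> K) (l : G -> K),
    [/\ definable_field cK /\ infinite_set [set: K],
        [/\ zmod_morphism i, bijective i & definable_map (dgcode V) cK i],
        [/\ zmod_morphism l, forall x y, l (br x y) = l x * l y - l y * l x,
            injective l & definable_map (dgcode G) cK l] &
        forall x v, i (act x v) = l x * i v].
Proof.
pose R := ring_gen (range act).
have cR : comm_endo_ring R.
  apply: ring_gen_comm_endo_ring; first by move=> _ [c _ <-]; exact: dendo_act.
  by move=> _ _ [c _ <-] [e _ <-]; exact: act_comm.
have Ract x : R (act x) by apply: RingGenIn; exists x.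
have comm f h : R f -> R h -> forall u, f (h u) = h (f u).
  by move=> Rf Rh u; have := congr1 (fun k : endo V => k u) (cerC cR Rf Rh).
have dich f : R f -> (forall u, [set: V] u -> f u = 0) \/ f @` setT = setT.
  move=> Rf; have cf : cdsub (f @` setT).
    by apply: cdsub_endo_image => //; exact: (cer_dendo cR).
  have [|f0|] := irr cf _; [|left|by right].
    by move=> x _ [u _ <-]; exists (act x u) => //; exact: comm.
  by move=> u _; have : [set 0] (f u) by rewrite -f0; exists u.
have stT f : R f -> stable f [set: V] by [].
have bn0 : exists x, exists2 u, [set: V] u & act x u <> 0.
  have [x /eqP x0] := G_neq0; exists x; apply: contrapT => h; apply/x0/act_eq0 => u.
  by apply: contrapT => h'; apply: h; exists u.
have [w _ w0] := exists_neq0 (subgroup_setT V) V_neq0.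
have eqR f h : R f -> R h -> f w = h w -> f = h.
  move=> Rf Rh fh; apply: endoP => u.
  exact: (endo_ring_eq rkV cR cVT stT dich cG actB Ract dact bn0 Rf Rh (u := w)).
have [D [g [dg0 Rg cU gR]]] :=
  endo_ring_family rkV cR cVT stT dich cG actB Ract dact bn0 (w := w) I w0.
have gRE f : R f -> exists t, f = g t.
  by move=> Rf; have [t ht] := gR f Rf; exists t; apply: endoP => u; exact: ht.
(* The connected group [R w] is invariant and contains [w], so it is [V]. *)
have UT : [set g t w | t in setT] = setT.
  have [|U0|//] := irr cU _.
    move=> x _ [t _ <-]; have [s hs] := gRE _ (cerM cR (Ract x) (Rg t)).
    by exists s => //; rewrite -hs.
  have [t ht] := gRE 1 (cer1 cR); case: w0.
  by have : [set 0] w by rewrite -U0; exists t => //; rewrite -ht.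
(* [m u] is the unique element of [R] that sends [w] to [u]. *)
have [m Hm] : {m : V -> endo V & forall u, R (m u) /\ m u w = u}.
  apply: (@choice _ _ (fun u f => R f /\ f w = u)) => u.
  have [t _ <-] : [set g t w | t in setT] u by rewrite UT.
  by exists (g t).
have Rm u : R (m u) by case: (Hm u).
have mw u : m u w = u by case: (Hm u).
have mE f : R f -> m (f w) = f by move=> Rf; apply: eqR => //; rewrite mw.
pose mul u v := m u v.
have mulE u v : m (mul u v) = m u * m v.
  by rewrite -(mE (m u * m v)) ?endo_mul_app ?mw//; exact: cerM.
have mulA : associative mul by move=> u v z; rewrite [RHS]/mul mulE.
have mulC : commutative mul.
  by move=> u v; rewrite /mul -{1}(mw v) comm// mw.
have m1 : m w = 1 by exact: eqR (Rm w) (cer1 cR) (mw w).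
have mul1 : left_id w mul by move=> u; rewrite /mul m1.
have mD u v : m (u + v) = m u + m v.
  by rewrite -(mE (m u + m v)) ?endo_add_app ?mw//; exact: cerD.
have mulDl : left_distributive mul +%R by move=> u v z; rewrite /mul mD.
have wn0 : w != 0 by apply/eqP.
(* The second clause makes the inverse of 0 equal to 0, as the field structure demands. *)
have inv_ex u : exists v, (u != 0 -> mul v u = w) /\ (u = 0 -> v = 0).
  have [->|un0] := eqVneq u 0; first by exists 0.
  have [mu0|muT] := dich _ (Rm u).
    by move: un0; rewrite -(mw u) mu0 ?eqxx.
  have [v _ vw] : (m u @` setT) w by rewrite muT.
  by exists v; split=> [_|u0]; [rewrite mulC|rewrite u0 eqxx in un0].
have [inv Hinv] := choice inv_ex.
pose F := FieldLaw mulA mulC mul1 mulDl wn0 (fun x => (Hinv x).1) ((Hinv 0).2 erefl).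
exists (field_of F), (dgcode V), id, (fun x => act x w).
split; [split; first split| | |].
- exact: dgcodeP.
(* The graph of the product is definable through the family [g]: if [g t w = u], then
   [g t = m u]. *)
- apply: (@dset_ext _ _ (dprod (dprod (dg V) (dg V)) (dg V)) [set z | exists t : D,
    (g t w : dg V) = z.1.1 /\ (g t z.1.2 : dg V) = z.2]).
    move=> [[u v] z] /=; split=> [[t [<- <-]]|<-].
      by rewrite /GRing.mul /= /mul mE.
    have [t ht] := gRE _ (Rm u).
    by exists t; rewrite -ht mw.
  apply: (@dset_ex _ _ (dprod (dprod (dg V) (dg V)) (dg V)) D (fun z t =>
    (g t w : dg V) = z.1.1 /\ (g t z.1.2 : dg V) = z.2)).
  apply: dset_and; apply: dset_eq.
  + by apply: endo_family_app dg0 (dmap_proj2 _ _) _; exact: dmap_cst.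
  + exact: dmap_fst (dmap_fst (dmap_proj1 _ _)).
  + apply: endo_family_app dg0 (dmap_proj2 _ _) _.
    exact: dmap_snd (dmap_fst (dmap_proj1 _ _)).
  + exact: dmap_snd (dmap_proj1 _ _).
(* If the field were finite, the connected group [V] would be zero. *)
- move=> /finite_seqP[s Es]; apply: V_neq0; apply: cdsub_finite cVT _.
  exists s => u _; exists u; last exact: subrr.
  by have : [set: V] u by []; rewrite Es.
- split; [by []|by exists id|exact: (dmap_id (dg V))].
- split.
  + by move=> x y; rewrite actB.
  + by move=> x y; rewrite br0 act0 mulrC subrr.
  + by move=> x y /(eqR _ _ (Ract x) (Ract y)) /act_inj.
  + suff h : @dmap _ _ (dg G) (dg V) (fun x => act x w) by exact: h.
    by apply: endo_family_app dact _ _; [exact: dmap_id|exact: dmap_cst].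
- by move=> x v; rewrite /GRing.mul /= /mul mE.
Qed.

End IrreducibleModules.

(** The ring is taken nonzero: the zero ring acts faithfully on a pure infinite vector space over a
    prime field [F_p], where no infinite field is definable. *)
Theorem corollary1p1 (L : language) (M : fostruct L)
    (r V : zmodType) (cr : code M r) (br : r -> r -> r)
    (cV : code M V) (rho : r -> V -> V) (p d : nat) :
  finite_morley_rank M ->
  definable_lie_ring cr br ->
  (exists x : r, x != 0) ->
  connected cr setT ->
  lie_soluble br ->
  definable_module cr br cV rho ->
  irreducible cV rho ->
  faithful rho ->
  module_char V p ->
  morley_rank (range cV) d ->
  (d < p)%N ->
  lie_abelian br /\ definably_linear cr br cV rho.
Proof.
move=> _ [lie dgr dbr] r_neq0 cnr sol [dgV cnV [rhoB rhoBl rho_br] drho] irr inj.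
(* Characteristic 0 is excluded by [d < p]. *)
case=> [[p_prime [_ pV _]]|[-> _]]; last by rewrite ltn0.
move=> /morley_rank_bound rkV lt_dp.
pose G := Dgroup dgr; pose W := Dgroup dgV.
pose act (x : G) : endo W := Endo (rhoB x).
have actB x y : act (x - y) = act x - act y by apply: endoP => v; exact: rhoBl.
have act_br x y : act (br x y) = act x * act y - act y * act x.
  by apply: endoP => v; exact: rho_br.
have act_inj : injective act.
  by move=> x y xy; apply: inj => v; exact: (congr1 (fun f : endo W => f v) xy).
have irrW (U : set W) : cdsub U -> (forall x, stable (act x) U) ->
    U = [set 0] \/ U = setT.
  by move=> [[sU dU] cU] stU; apply: irr => // x v Uv; exact: stU.
have br0 := @soluble_abelian _ _ G W br act d p rkV p_prime pV lt_dp lie dbr cnr cnV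
  actB act_br act_inj drho irrW r_neq0 sol.
split; first exact: lie_abelianP.
have [K [cK [i [l [hK hi hl hact]]]]] := @abelian_linear _ _ G W br act d rkV
  cnr cnV actB act_br act_inj drho irrW r_neq0 br0.
by exists K, cK, i, l.
Qed.
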